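(* Let $\mathrm{PD}_t(n)$ denote the total number of tagged parts over all partitions of $n$ with designated summands. For all nonnegative integers $k,\ell,n$: \begin{align*} &\mathrm{PD}_t(24n+12)\equiv 0\pmod 2,\quad \mathrm{PD}_t(24n+21)\equiv 0\pmod 2,\quad \mathrm{PD}_t(48n+30)\equiv 0\pmod 2,\\ &\mathrm{PD}_t(144n+102)\equiv 0\pmod 2,\quad \mathrm{PD}_t(216n+153)\equiv 0\pmod 2,\\ &\mathrm{PD}_t(36n+21)\equiv 0\pmod 4,\quad \mathrm{PD}_t(36n+33)\equiv 0\pmod 4,\\ &\mathrm{PD}_t(2^{2k}\cdot 12n)\equiv \mathrm{PD}_t(12n)\pmod 4,\\ &\mathrm{PD}_t(3^{\ell}\cdot 2^{2k}(24n+12))\equiv \mathrm{PD}_t(24n+12)\pmod 4,\\ &\mathrm{PD}_t(96n+60)\equiv 0\pmod 4,\quad \mathrm{PD}_t(96n+84)\equiv 0\pmod 4,\quad \mathrm{PD}_t(144n+84)\equiv 0\pmod 4,\\ &\mathrm{PD}_t(144n+120)\equiv 0\pmod 4,\quad \mathrm{PD}_t(144n+132)\equiv 0\pmod 4,\\ &\mathrm{PD}_t(3^k(288n+204))\equiv \mathrm{PD}_t(288n+204)\equiv 0\pmod 4,\\ &\mathrm{PD}_t(864n+792)\equiv 0\pmod 4,\quad \mathrm{PD}_t(1728n+1224)\equiv 0\pmod 4,\quad \mathrm{PD}_t(2592n+1080)\equiv 0\pmod 4,\\ &\mathrm{PD}_t(36n+30)\equiv 0\pmod 4,\quad \mathrm{PD}_t(108n+90)\equiv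 0\pmod 4,\\ &\mathrm{PD}_t(3^{2k}(12n+6))\equiv \mathrm{PD}_t(12n+6)\pmod 4. \end{align*}
   Context: A partition of $n$ with designated summands is an ordinary partition of $n$ in which exactly one part of each distinct part size is tagged; e.g. $2'+2$ and $2+2'$ are different partitions of $4$ with designated summands. $\mathrm{PD}_t(n)$ is the sum, over all partitions of $n$ with designated summands, of the number of tagged parts. With $f_k:=\prod_{m\ge1}(1-q^{km})$, its generating function is known to be $\sum_{n\ge0}\mathrm{PD}_t(n)q^n=\frac12\left(\frac{f_3^5}{f_1^3f_6^2}-\frac{f_6}{f_1f_2f_3}\right)$. *)

(* Defs.v *)
From mathcomp Require Import all_boot.

Set Implicit Arguments.
Unset Strict Implicit.
Unset Printing Implicit Defensive.

(* A part is a pair (size, tag), and parts are listed by nonincreasing size;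
   the position of the tag among equal parts matters, so that
   [:: (2, true); (2, false)] and [:: (2, false); (2, true)] (that is,
   2' + 2 and 2 + 2') are different. *)
Definition designated (n : nat) (s : seq (nat * bool)) : bool :=
  [&& sorted geq (unzip1 s),
      0 \notin unzip1 s,
      sumn (unzip1 s) == n
    & all (fun j => count_mem (j, true) s == 1) (unzip1 s)].

(* A partition of n has at most n parts, each of size at most n, so this
   finite type holds all of them (see designated_tparts). *)
Definition tparts (n : nat) := n.-bseq ('I_n.+1 * bool)%type.

Definition tparts_seq (n : nat) (s : tparts n) : seq (nat * bool) :=
  [seq (nat_of_ord x.1, x.2) | x <- s].

Definition PDt (n : nat) : nat :=
  \sum_(s : tparts n | designated n (tparts_seq s)) count snd (tparts_seq s).

Lemma tparts_seq_inj n : injective (@tparts_seq n).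
Proof.
move=> s t eq_st; apply/val_inj; apply: inj_map eq_st.
by move=> [i b] [j c] [/ord_inj-> ->].
Qed.

Lemma designated_tparts n s :
  designated n s -> exists t : tparts n, tparts_seq t = s.
Proof.
case/and4P=> _ s0 /eqP sum_s _.
have [size_s le_s] : size s <= n /\ all (fun x => x.1 < n.+1) s.
  rewrite -{}sum_s; elim: s s0 => //= x s IHs.
  rewrite inE negb_or eq_sym -lt0n => /andP[x0 /IHs[size_s le_s]]; split.
    by rewrite -add1n leq_add.
  rewrite ltnS leq_addr; apply: sub_all le_s => y /leq_trans; apply.
  by rewrite ltnS leq_addl.
have size_t : size [seq (inord x.1 : 'I_n.+1, x.2) | x <- s] <= n.
  by rewrite size_map.
exists (Bseq size_t); rewrite /tparts_seq /= -map_comp -[RHS]map_id.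
by apply/eq_in_map => -[i b] /(allP le_s)/= le_i; rewrite inordK.
Qed.

(* Main.v *)
Require Import Defs.
From HB Require Import structures.
From mathcomp Require Import all_boot all_order all_algebra.
From mathcomp.classical Require Import boolp.
From mathcomp Require Import ring zify.

(** Write [f_k] for the product of the [1 - q^(k m)], [psi] for the sum of the
    [q^(n(n+1)/2)], [phi] for the sum over [Z] of the [q^(n^2)].  The product of
    the [1 - y q^m + q^(2m)] times [f_1] is a theta series in [y] (a symmetric
    form of the triple product).  Its derivative at [y = 1] expands
    [f_1^3 * sum PDt(n) q^n], and its values at [y = 2, 1, 0, -1, -2] give all
    the product formulas that are needed.  The exponents being triangular
    numbers, trisection is immediate and yields [sum PDt(3n) q^n].

    Modulo 4 this series can be bisected repeatedly with the help of
    [psi(q) psi(q^3) = psi(q^4) phi(q^6) + q phi(q^2) psi(q^12)], a change of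
    variables in a lattice sum.  If [p(n)] denotes the coefficients of
    [psi(q) psi(q^3)], the outcome is, modulo 4,
    [PDt(12n+6) = p(n)], [PDt(24n+12) = 2 p(n)], [PDt(24n) = PDt(6n)] and
    [sum PDt(12n+9) q^n = f_3^6].  All congruences follow from
    [p(3n+1) = p(n)], [p(3n+2) = 0] and the parity of [p]. *)

Set Implicit Arguments.
Unset Strict Implicit.
Unset Printing Implicit Defensive.

Import Order.TTheory GRing.Theory Num.Theory.
Local Open Scope ring_scope.

(** * Formal power series *)

(** The coefficients of [f1 ^+ 3 * PDtser] are linear in [k] up to periodic corrections, and no
    product formula is used for this series. At the indices [k] that are not 1 modulo 3, however,
    their doubles agree modulo 8 with a fixed combination of the coefficients of [f 3], [psi] and
    [f1 ^+ 3]. The section at exponents divisible by 3 sees only these indices, so the numerator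
    [n0] becomes known modulo 4 after halving. One term, the cube of [psi(q^3)] that occurs in [c0],
    carries a factor 4; after halving only its parity counts, and this is settled by an algebraic
    equation over the field of two elements.

    Modulo 4 the algebra collapses: [phi(-q)] is 1 plus an even series and has square 1,
    [f_2 = phi(-q) f_1^2] and [psi = f_1^3]. The denominator left over is [f_1^12], which modulo 4
    is a series in [q^2], so that bisecting acts on numerators only. *)

Record fps (R : Type) := Fps { cf : nat -> R }.
Arguments Fps {R} _.

HB.instance Definition _ R := gen_eqMixin (fps R).
HB.instance Definition _ R := gen_choiceMixin (fps R).

Lemma fpsP R (a b : fps R) : (forall n, cf a n = cf b n) -> a = b.
Proof. by case: a b => [a] [b] /= /funext ->. Qed.

Section FpsRing.
Variable R : comNzRingType.
Implicit Types a b c : fps R.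

(* The operations are locked: unification would otherwise unfold series to
   their coefficient functions and diverge. *)
Fact fps_key : unit. Proof. by []. Qed.
Definition fps_add := locked_with fps_key (fun a b => Fps (fun n => cf a n + cf b n)).
Definition fps_opp := locked_with fps_key (fun a => Fps (fun n => - cf a n)).
Lemma cf_fps_add a b n : cf (fps_add a b) n = cf a n + cf b n.
Proof. by rewrite /fps_add unlock. Qed.
Lemma cf_fps_opp a n : cf (fps_opp a) n = - cf a n.
Proof. by rewrite /fps_opp unlock. Qed.
Definition fps_zero : fps R := Fps (fun _ => 0).

Fact fps_addA : associative fps_add.
Proof. by move=> a b c; apply: fpsP => n; rewrite !(cf_fps_add, cf_fps_opp) ?addrA. Qed.
Fact fps_addC : commutative fps_add.
Proof. by move=> a b; apply: fpsP => n; rewrite !cf_fps_add addrC. Qed.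
Fact fps_add0 : left_id fps_zero fps_add.
Proof. by move=> a; apply: fpsP => n; rewrite !(cf_fps_add, cf_fps_opp) ?add0r. Qed.
Fact fps_addN : left_inverse fps_zero fps_opp fps_add.
Proof. by move=> a; apply: fpsP => n; rewrite !(cf_fps_add, cf_fps_opp) ?addNr. Qed.

HB.instance Definition _ :=
  GRing.isZmodule.Build (fps R) fps_addA fps_addC fps_add0 fps_addN.

Definition trunc n a := \poly_(i < n.+1) cf a i.
(** Multiplying truncations as polynomials lets the ring axioms be inherited from [{poly R}]; the
    convolution formula is recovered in [cfM]. *)
Definition fps_mul :=
  locked_with fps_key (fun a b => Fps (fun n => (trunc n a * trunc n b)`_n)).
Lemma cf_fps_mul a b n : cf (fps_mul a b) n = (trunc n a * trunc n b)`_n.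
Proof. by rewrite /fps_mul unlock. Qed.
Definition fps_one : fps R := Fps (fun n => (n == 0%N)%:R).

Lemma coef_trunc n a i : (i <= n)%N -> (trunc n a)`_i = cf a i.
Proof. by move=> le; rewrite coef_poly ltnS le. Qed.

Lemma coef_mul_agree (p p' q q' : {poly R}) n :
  (forall i, (i <= n)%N -> p`_i = p'`_i) ->
  (forall i, (i <= n)%N -> q`_i = q'`_i) -> (p * q)`_n = (p' * q')`_n.
Proof.
move=> Hp Hq; rewrite !coefM; apply: eq_bigr => i _.
by rewrite Hp ?Hq ?leq_subr // -ltnS.
Qed.

Lemma cf_mul_trunc N n a b : (n <= N)%N ->
  cf (fps_mul a b) n = (trunc N a * trunc N b)`_n.
Proof.
by move=> le; rewrite cf_fps_mul; apply: coef_mul_agree => i lei;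
  rewrite !coef_trunc // (leq_trans lei).
Qed.

Fact fps_mulA : associative fps_mul.
Proof.
move=> a b c; apply: fpsP => n.
rewrite !cf_fps_mul [LHS](_ : _ = (trunc n a * (trunc n b * trunc n c))`_n);
  last first.
  apply: coef_mul_agree => i lei //.
  by rewrite coef_trunc // (cf_mul_trunc _ _ lei).
rewrite mulrA; apply: coef_mul_agree => i lei //.
by rewrite coef_trunc // (cf_mul_trunc _ _ lei).
Qed.
Fact fps_mulC : commutative fps_mul.
Proof. by move=> a b; apply: fpsP => n; rewrite !cf_fps_mul mulrC. Qed.
Fact fps_mul1 : left_id fps_one fps_mul.
Proof.
move=> a; apply: fpsP => n; rewrite cf_fps_mul [LHS](_ : _ = (1 * trunc n a)`_n).
  by rewrite mul1r coef_trunc.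
by apply: coef_mul_agree => i lei //; rewrite coef_trunc // coef1.
Qed.
Fact fps_mulD : left_distributive fps_mul fps_add.
Proof.
move=> a b c; apply: fpsP => n; rewrite cf_fps_add !cf_fps_mul -coefD -mulrDl.
by apply: coef_mul_agree => i lei //; rewrite coefD !coef_trunc // cf_fps_add.
Qed.
Fact fps_1_neq0 : fps_one != fps_zero.
Proof.
apply/eqP => /(congr1 (fun a => cf a 0)) /= /eqP.
by rewrite oner_eq0.
Qed.

HB.instance Definition _ := GRing.Zmodule_isComNzRing.Build (fps R)
  fps_mulA fps_mulC fps_mul1 fps_mulD fps_1_neq0.

Lemma cfD a b n : cf (a + b) n = cf a n + cf b n.
Proof. exact: cf_fps_add. Qed.
Lemma cfN a n : cf (- a) n = - cf a n. Proof. exact: cf_fps_opp. Qed.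
Lemma cfB a b n : cf (a - b) n = cf a n - cf b n.
Proof. by rewrite cfD cfN. Qed.
Lemma cf0 n : cf (0 : fps R) n = 0. Proof. by []. Qed.
Lemma cf1 n : cf (1 : fps R) n = (n == 0%N)%:R. Proof. by []. Qed.

Lemma cfM a b n : cf (a * b) n = \sum_(i < n.+1) cf a i * cf b (n - i)%N.
Proof.
rewrite [LHS]cf_fps_mul coefM; apply: eq_bigr => i _.
by rewrite !coef_trunc ?leq_subr // -ltnS.
Qed.

Lemma cfM0 a b : cf (a * b) 0 = cf a 0 * cf b 0.
Proof. by rewrite cfM big_ord1. Qed.

Lemma cf_sum (I : Type) (r : seq I) (Q : pred I) (F : I -> fps R) n :
  cf (\sum_(i <- r | Q i) F i) n = \sum_(i <- r | Q i) cf (F i) n.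
Proof. by elim/big_rec2: _ => // i x y _ <-; rewrite cfD. Qed.

Lemma cf_natmul a k n : cf (a *+ k) n = cf a n *+ k.
Proof. by elim: k => // k IH; rewrite !mulrS cfD IH. Qed.

Lemma cf_nat k n : cf (k%:R : fps R) n = if n == 0%N then k%:R else 0.
Proof. by rewrite cf_natmul cf1; case: eqP => _ //; rewrite mul0rn. Qed.

Lemma cf_natM k a n : cf (k%:R * a) n = k%:R * cf a n.
Proof. by rewrite !mulr_natl cf_natmul. Qed.

Lemma cf_expr0 a k : cf a 0 = 1 -> cf (a ^+ k) 0 = 1.
Proof. by move=> a0; elim: k => // k IH; rewrite exprS cfM0 a0 IH mulr1. Qed.

Definition qm m : fps R := Fps (fun n => (n == m)%:R).

Lemma cf_qmM m a n : cf (qm m * a) n = if (m <= n)%N then cf a (n - m)%N else 0.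
Proof.
rewrite cfM; case: leqP => [le|gt].
  rewrite (bigD1 (Ordinal (le : (m < n.+1)%N))) //= eqxx mul1r big1 ?addr0 // => i.
  by rewrite -val_eqE /= => /negbTE->; rewrite mul0r.
rewrite big1 // => i _ /=; case: eqP => [e|_]; last by rewrite mul0r.
by have := ltn_ord i; rewrite e ltnS leqNgt gt.
Qed.

Lemma qm0 : qm 0 = 1. Proof. by []. Qed.

Lemma qmD m n : qm (m + n)%N = qm m * qm n.
Proof.
apply: fpsP => k; rewrite cf_qmM /=; case: leqP => h.
  by congr (_%:R); apply/eqP/eqP; lia.
by case: eqP => // e; lia.
Qed.

Lemma qmX m n : qm m ^+ n = qm (m * n)%N.
Proof.
elim: n => [|n IH]; first by rewrite muln0 expr0 qm0.
by rewrite exprS IH mulnS qmD.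
Qed.

Lemma qmE n : qm n = qm 1 ^+ n. Proof. by rewrite qmX mul1n. Qed.

(** ** Congruence modulo a power of [q] *)

Definition eqq N a b := forall i, (i < N)%N -> cf a i = cf b i.

Lemma eqq_refl N a : eqq N a a. Proof. by []. Qed.
Lemma eqq_sym N a b : eqq N a b -> eqq N b a.
Proof. by move=> h i /h. Qed.
Lemma eqq_trans N b a c : eqq N a b -> eqq N b c -> eqq N a c.
Proof. by move=> h k i hi; rewrite h ?k. Qed.
Lemma eqqW M N a b : (M <= N)%N -> eqq N a b -> eqq M a b.
Proof. by move=> le h i hi; apply/h/(leq_trans hi). Qed.
Lemma eqqD N a a' b b' : eqq N a a' -> eqq N b b' -> eqq N (a + b) (a' + b').
Proof. by move=> h k i hi; rewrite !cfD h ?k. Qed.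
Lemma eqqN N a a' : eqq N a a' -> eqq N (- a) (- a').
Proof. by move=> h i hi; rewrite !cfN h. Qed.
Lemma eqqM N a a' b b' : eqq N a a' -> eqq N b b' -> eqq N (a * b) (a' * b').
Proof.
move=> h k i hi; rewrite !cfM; apply: eq_bigr => j _.
by have := ltn_ord j => hj; rewrite h ?k //; lia.
Qed.
Lemma eqqX N a a' n : eqq N a a' -> eqq N (a ^+ n) (a' ^+ n).
Proof. by move=> h; elim: n => // n IH; rewrite !exprS; apply: eqqM. Qed.
Lemma eqq_sum N (I : Type) (r : seq I) (Q : pred I) (F G : I -> fps R) :
  (forall i, Q i -> eqq N (F i) (G i)) ->
  eqq N (\sum_(i <- r | Q i) F i) (\sum_(i <- r | Q i) G i).
Proof. by move=> h; elim/big_rec2: _ => // i x y /h; apply: eqqD. Qed.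
Lemma eqq_qmM m N a b : eqq N a b -> eqq (m + N)%N (qm m * a) (qm m * b).
Proof.
move=> h i hi; rewrite !cf_qmM; case: leqP => // le; apply: h; lia.
Qed.
Lemma eqq_qm0 m N a : (N <= m)%N -> eqq N (qm m * a) 0.
Proof. by move=> le i hi; rewrite cf_qmM cf0; case: leqP => // h; lia. Qed.
Lemma eqq_all a b : (forall N, eqq N a b) -> a = b.
Proof. by move=> h; apply: fpsP => n; apply: (h n.+1). Qed.

Lemma eqq_expr0 a n : cf a 0 = 0 -> eqq n (a ^+ n) 0.
Proof.
move=> a0; have -> : a = qm 1 * Fps (fun n => cf a n.+1).
  apply: fpsP => k; rewrite cf_qmM; case: k => [|k]; first by rewrite a0.
  by rewrite /= subn1.
by rewrite exprMn -qmE; apply: eqq_qm0.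
Qed.

(** The geometric series in [1 - a]. If [a] has constant coefficient 1, the powers beyond the [n]-th
    do not reach the coefficient [n]. *)
Definition fps_inv a := Fps (fun n => cf (\sum_(k < n.+1) (1 - a) ^+ k) n).

Lemma fps_invE a n : cf a 0 = 1 ->
  eqq n (fps_inv a) (\sum_(k < n) (1 - a) ^+ k).
Proof.
move=> a0 i hi; rewrite /= !cf_sum.
rewrite -(big_mkord xpredT (fun k => cf ((1 - a) ^+ k) i)).
rewrite -(big_mkord xpredT (fun k => cf ((1 - a) ^+ k) i)).
rewrite (@big_cat_nat _ _ _ i.+1 0 n) //= -[LHS]addr0; congr (_ + _).
rewrite big_nat_cond big1 // => k /andP[/andP[lk _] _].
by rewrite (@eqq_expr0 _ k) // cfB a0 cf1 subrr.
Qed.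

Lemma fps_invP a : cf a 0 = 1 -> a * fps_inv a = 1.
Proof.
move=> a0; apply: eqq_all => N.
apply: eqq_trans (eqqM (@eqq_refl N a) (fps_invE a0)) _.
have -> : a * (\sum_(k < N) (1 - a) ^+ k) = 1 - (1 - a) ^+ N.
  have -> : 1 - (1 - a) ^+ N = - ((1 - a) ^+ N - 1) by ring.
  rewrite subrX1 -mulNr; congr (_ * _); ring.
rewrite -[X in eqq N _ X]subr0; apply: eqqD => //; apply: eqqN.
by apply: eqq_expr0; rewrite cfB a0 cf1 subrr.
Qed.

Lemma fps_mulI c a b : cf c 0 = 1 -> c * a = c * b -> a = b.
Proof.
move=> c0 e; rewrite -[a]mul1r -[b]mul1r -(fps_invP c0).
by rewrite [c * _]mulrC -!mulrA e.
Qed.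

(** ** Dilation, scaling and sections *)

Definition dil (k : nat) a : fps R := locked_with fps_key
  (fun k a => Fps (fun n => if (k %| n)%N then cf a (n %/ k)%N else 0)) k a.
Definition scal (u : R) a := Fps (fun n => u ^+ n * cf a n).
Definition sec m r a := Fps (fun n => cf a (m * n + r)%N).

Lemma cf_dilE k a n :
  cf (dil k a) n = if (k %| n)%N then cf a (n %/ k)%N else 0.
Proof. by rewrite /dil unlock. Qed.
Lemma cf_secE m r a n : cf (sec m r a) n = cf a (m * n + r)%N.
Proof. by []. Qed.
Lemma cf_scalE u a n : cf (scal u a) n = u ^+ n * cf a n.
Proof. by []. Qed.

Lemma cf_dil k a n : (0 < k)%N -> cf (dil k a) (k * n)%N = cf a n.
Proof. by move=> k0; rewrite cf_dilE dvdn_mulr // mulKn. Qed.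
Lemma cf_dilN k a n r : (0 < r < k)%N -> cf (dil k a) (k * n + r)%N = 0.
Proof.
by case/andP=> r0 rk; rewrite cf_dilE dvdn_addr ?dvdn_mulr // gtnNdvd.
Qed.

Lemma cf_dil_gt0 k a : (0 < k)%N -> cf (dil k a) 0 = cf a 0.
Proof. by move=> k0; rewrite -{1}(muln0 k) cf_dil. Qed.

Lemma dil1 k : (0 < k)%N -> dil k 1 = 1.
Proof.
move=> k0; apply: fpsP => n; rewrite cf_dilE /=; case: ifP => h.
  by rewrite -{2}(divnK h) muln_eq0 [k == 0%N]eqn0Ngt k0 orbF.
by case: eqP h => // ->; rewrite dvdn0.
Qed.

Lemma dil_id a : dil 1 a = a.
Proof. by apply: fpsP => n; rewrite cf_dilE dvd1n divn1. Qed.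

Lemma dilD k : {morph dil k : a b / a + b}.
Proof. by move=> a b; apply: fpsP => n; rewrite !(cf_dilE, cfD); case: ifP; rewrite ?addr0. Qed.

Lemma dilN k : {morph dil k : a / - a}.
Proof. by move=> a; apply: fpsP => n; rewrite !(cf_dilE, cfN); case: ifP; rewrite ?oppr0. Qed.

Lemma dilB k : {morph dil k : a b / a - b}.
Proof. by move=> a b; rewrite dilD dilN. Qed.

Lemma dil_qm k m : (0 < k)%N -> dil k (qm m) = qm (k * m)%N.
Proof.
move=> k0; apply: fpsP => n; rewrite cf_dilE /=; case: ifP => h.
  by rewrite eq_sym eqn_div // mulnC eq_sym.
by case: eqP h => // ->; rewrite dvdn_mulr.
Qed.

Lemma eqq_dil k N a b : (0 < k)%N -> eqq N a b -> eqq (k * N)%N (dil k a) (dil k b).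
Proof.
move=> k0 h i hi; rewrite !cf_dilE; case: ifP => // /dvdnP[j e]; apply: h.
by move: hi; rewrite e mulnK // mulnC ltn_pmul2l.
Qed.

Lemma secD m r : {morph sec m r : a b / a + b}.
Proof. by move=> *; apply: fpsP => n; rewrite !(cf_secE, cfD). Qed.
Lemma secB m r : {morph sec m r : a b / a - b}.
Proof. by move=> *; apply: fpsP => n; rewrite !(cf_secE, cfB). Qed.

Lemma sec_natmul m r k a : sec m r (k%:R * a) = k%:R * sec m r a.
Proof. by apply: fpsP => n; rewrite !(cf_natM, cf_secE). Qed.

Lemma sec_dil m r a : (0 < m)%N -> (r < m)%N ->
  sec m r (dil m a) = if r == 0%N then a else 0.
Proof.
move=> m0 rm; apply: fpsP => n; case: eqP => [-> | /eqP r0].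
  by rewrite cf_secE addn0 cf_dil.
by rewrite cf_secE cf_dilN // lt0n r0.
Qed.

Lemma sum_dvdn (F : nat -> R) m n r : (0 < m)%N -> (r < m)%N ->
  \sum_(i < (m * n + r).+1 | (m %| i)%N) F i = \sum_(j < n.+1) F (m * j)%N.
Proof.
move=> m0 rm; pose h (j : 'I_n.+1) : 'I_(m * n + r).+1 := inord (m * j).
have hE j : h j = (m * j)%N :> nat.
  rewrite inordK // ltnS; apply: leq_trans (leq_addr r _).
  by rewrite leq_mul2l -ltnS ltn_ord orbT.
have div_lt (i : 'I_(m * n + r).+1) : (i %/ m < n.+1)%N.
  have := ltn_ord i; rewrite ltn_divLR // ltnS => /leq_ltn_trans; apply.
  by rewrite mulSn mulnC addnC ltn_add2r.
pose h' (i : 'I_(m * n + r).+1) : 'I_n.+1 := Ordinal (div_lt i).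
rewrite (reindex_onto h h') => [|i mi]; last first.
  by apply: val_inj; rewrite /= hE /= mulnC divnK.
apply: eq_big => [j|j _]; last by rewrite hE.
by rewrite hE dvdn_mulr //=; apply/eqP/val_inj; rewrite /= hE mulKn.
Qed.

(** A factor that is a series in [q^m] leaves the section. The dissections below are arranged so
    that this rule applies. *)
Lemma sec_dilM m r a b : (0 < m)%N -> (r < m)%N ->
  sec m r (dil m a * b) = a * sec m r b.
Proof.
move=> m0 rm; apply: fpsP => n; rewrite cf_secE !cfM.
rewrite (bigID (fun i : 'I__ => m %| i)%N) /= [X in _ + X]big1 ?addr0; last first.
  by move=> i /negbTE h; rewrite cf_dilE h mul0r.
under eq_bigr => i h do rewrite cf_dilE h.
rewrite (sum_dvdn (fun i => cf a (i %/ m) * cf b (m * n + r - i)%N)) //.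
apply: eq_bigr => j _; rewrite mulKn //; congr (_ * cf b _).
have lj : (m * j <= m * n)%N by rewrite leq_pmul2l // -ltnS.
by rewrite mulnBr addnBAC.
Qed.

Lemma sec_inj m a b : (0 < m)%N ->
  (forall r, (r < m)%N -> sec m r a = sec m r b) -> a = b.
Proof.
move=> m0 h; apply: fpsP => n; rewrite (divn_eq n m) mulnC.
by rewrite -!cf_secE h ?ltn_pmod.
Qed.

Lemma dilM k : (0 < k)%N -> {morph dil k : a b / a * b}.
Proof.
move=> k0 a b; apply: (sec_inj k0) => r rk.
by rewrite sec_dilM // !sec_dil //; case: eqP; rewrite ?mulr0.
Qed.

Lemma dilX k n : (0 < k)%N -> {morph dil k : a / a ^+ n}.
Proof.
by move=> k0 a; elim: n => [|n IH]; rewrite ?dil1 // !exprS dilM ?IH.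
Qed.

Lemma dil_natM k n a : dil k (n%:R * a) = n%:R * dil k a.
Proof. by apply: fpsP => i; rewrite !(cf_natM, cf_dilE); case: ifP; rewrite ?mulr0. Qed.

Lemma dil_nat k n : (0 < k)%N -> dil k (n%:R) = n%:R.
Proof. by move=> k0; rewrite -[n%:R]mulr1 dil_natM dil1. Qed.

Lemma dil_dil k m a : (0 < k)%N -> (0 < m)%N -> dil k (dil m a) = dil (k * m)%N a.
Proof.
move=> k0 m0; apply: fpsP => n; rewrite !cf_dilE -divnMA.
by case: (boolP (k %| n)%N) => [h|/negbTE h]; rewrite ?dvdn_divRL ?[(m * k)%N]mulnC //;
  case: ifP => // /(dvdn_trans (dvdn_mulr m (dvdnn k))); rewrite h.
Qed.

Lemma dil_inj k : (0 < k)%N -> injective (dil k).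
Proof.
by move=> k0 a b /(congr1 (sec k 0)); rewrite !sec_dil.
Qed.

Lemma sec_qM m r a : sec m r.+1 (qm 1 * a) = sec m r a.
Proof. by apply: fpsP => n; rewrite [LHS]cf_qmM addnS ltnS leq0n subn1. Qed.

Lemma sec0_qM m a : sec m.+1 0 (qm 1 * a) = qm 1 * sec m.+1 m a.
Proof.
apply: fpsP => n; rewrite cf_secE !cf_qmM addn0.
case: n => [|n]; first by rewrite muln0.
by rewrite mulnS /= subn1 /=; congr (cf a _); lia.
Qed.

Lemma sec_split2 a : a = dil 2 (sec 2 0 a) + qm 1 * dil 2 (sec 2 1 a).
Proof.
apply: (@sec_inj 2) => // -[|[|]] // _.
  by rewrite secD sec0_qM !sec_dil // mulr0 addr0.
by rewrite secD sec_qM !sec_dil // add0r.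
Qed.

Lemma sec_split3 a :
  a = dil 3 (sec 3 0 a) + qm 1 * dil 3 (sec 3 1 a) +
      qm 2 * dil 3 (sec 3 2 a).
Proof.
apply: (@sec_inj 3) => // -[|[|[|]]] // _; rewrite !secD (qmD 1 1) -mulrA.
- by rewrite !(sec0_qM, sec_qM) !sec_dil // mulr0 !addr0.
- by rewrite !(sec0_qM, sec_qM) !sec_dil // mulr0 add0r addr0.
- by rewrite !(sec0_qM, sec_qM) !sec_dil // !add0r.
Qed.

Definition neg := scal (-1).

Lemma negD : {morph neg : a b / a + b}.
Proof. by move=> a b; apply: fpsP => n; rewrite !(cf_scalE, cfD) mulrDr. Qed.
Lemma negM : {morph neg : a b / a * b}.
Proof.
move=> a b; apply: fpsP => n; rewrite cf_scalE !cfM mulr_sumr.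
apply: eq_bigr => i _; have := ltn_ord i; rewrite ltnS => le.
by rewrite !cf_scalE mulrACA -exprD subnKC.
Qed.
Lemma neg1 : neg 1 = 1.
Proof. by apply: fpsP => -[|n]; rewrite /= ?expr0 ?mulr1 ?mulr0. Qed.
Lemma neg_natM k a : neg (k%:R * a) = k%:R * neg a.
Proof. by apply: fpsP => n; rewrite !(cf_natM, cf_scalE) mulrCA. Qed.
Lemma neg_q : neg (qm 1) = - qm 1.
Proof.
by apply: fpsP => n; rewrite cfN /=; case: eqP => [->|_]; rewrite ?mulr1 ?expr1 ?mulr0 ?oppr0.
Qed.
Lemma neg_dil2 k a : ~~ odd k -> neg (dil k a) = dil k a.
Proof.
move=> ek; apply: fpsP => n; rewrite cf_scalE !cf_dilE; case: ifP => [/dvdnP[j ->]|_]; last by rewrite mulr0.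
by rewrite -signr_odd oddM (negbTE ek) andbF mul1r.
Qed.
Lemma sec_neg0 a : sec 2 0 (neg a) = sec 2 0 a.
Proof.
by apply: fpsP => n /=; rewrite addn0 -signr_odd oddM mul1r.
Qed.
Lemma sec_neg1 a : sec 2 1 (neg a) = - sec 2 1 a.
Proof.
by apply: fpsP => n; rewrite cfN /= -signr_odd oddD oddM expr1 mulN1r.
Qed.
End FpsRing.

Arguments cf {R} _ _%_N.
Arguments qm {R} m%_N.
Arguments eqq {R} N%_N a b.
Arguments dil {R} k%_N a.
Arguments sec {R} m%_N r%_N a.
Arguments eqq_refl {R} N a.
#[global] Hint Resolve eqq_refl : core.

(** * Change of the coefficient ring *)

Section MapFps.
Variables (R S : comNzRingType) (f : {rmorphism R -> S}).

Definition mapf (a : fps R) : fps S := Fps (fun n => f (cf a n)).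

Lemma cf_mapf a n : cf (mapf a) n = f (cf a n). Proof. by []. Qed.

Fact mapf_additive : zmod_morphism mapf.
Proof. by move=> a b; apply: fpsP => n; rewrite cfB /= cfB rmorphB. Qed.
HB.instance Definition _ :=
  GRing.isZmodMorphism.Build (fps R) (fps S) mapf mapf_additive.

Fact mapf_multiplicative : monoid_morphism mapf.
Proof.
split=> [|a b]; apply: fpsP => n; first by rewrite /= rmorph_nat.
rewrite cf_mapf !cfM rmorph_sum; apply: eq_bigr => i _.
by rewrite rmorphM.
Qed.
HB.instance Definition _ :=
  GRing.isMonoidMorphism.Build (fps R) (fps S) mapf mapf_multiplicative.

Lemma mapf_qm n : mapf (qm n) = qm n.
Proof. by apply: fpsP => i; rewrite /= rmorph_nat. Qed.
Lemma mapf_dil k a : mapf (dil k a) = dil k (mapf a).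
Proof. by apply: fpsP => i; rewrite cf_mapf !cf_dilE; case: ifP; rewrite ?rmorph0. Qed.
Lemma mapf_sec m r a : mapf (sec m r a) = sec m r (mapf a).
Proof. by []. Qed.
Lemma mapf_neg a : mapf (neg a) = neg (mapf a).
Proof. by apply: fpsP => i; rewrite /= rmorphM rmorphXn rmorphN1. Qed.
End MapFps.

(** * A triple product identity *)

Section InfiniteProduct.
Variable R : comNzRingType.
Implicit Types F G : nat -> fps R.

(** The factor [F m] affects only coefficients beyond [m], so the coefficient [n] of the product is
    settled after [n] factors. *)
Definition pgood F := forall m, eqq m.+1 (F m) 1.

Definition iprod F : fps R := Fps (fun n => cf (\prod_(m < n) F m) n).

Lemma eqq_prod_le F n N : pgood F -> (n <= N)%N ->
  eqq n.+1 (\prod_(m < N) F m) (\prod_(m < n) F m).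
Proof.
move=> gF; elim: N => [|N IH]; first by rewrite leqn0 => /eqP->.
rewrite leq_eqVlt => /predU1P[-> //|lt]; rewrite big_ord_recr /=.
rewrite -[X in eqq _ _ X]mulr1; apply: eqqM; first exact: IH.
by apply: eqqW (gF N).
Qed.

Lemma iprodE F n : pgood F -> eqq n.+1 (iprod F) (\prod_(m < n) F m).
Proof. by move=> gF i lei; rewrite /= (eqq_prod_le gF (lei : i <= n)%N). Qed.

Lemma iprod_unique F a : pgood F ->
  (forall n, eqq n.+1 a (\prod_(m < n) F m)) -> a = iprod F.
Proof. by move=> gF h; apply: fpsP => n; apply: (h n). Qed.

Lemma pgoodM F G : pgood F -> pgood G -> pgood (fun m => F m * G m).
Proof. by move=> gF gG m; rewrite -[1]mulr1; apply: eqqM. Qed.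

Lemma iprodM F G : pgood F -> pgood G ->
  iprod F * iprod G = iprod (fun m => F m * G m).
Proof.
move=> gF gG; apply: iprod_unique (pgoodM gF gG) _ => n.
by rewrite big_split; apply: eqqM; apply: iprodE.
Qed.

Lemma eq_iprod F G : F =1 G -> iprod F = iprod G.
Proof.
by move=> e; apply: fpsP => n /=; congr cf; apply: eq_bigr => i _; apply: e.
Qed.

Lemma iprod_dil k F : (0 < k)%N -> pgood F ->
  dil k (iprod F) = iprod (fun m => dil k (F m)).
Proof.
move=> k0 gF; have le m : (m <= k * m)%N by rewrite leq_pmull.
apply: iprod_unique => [m|n].
  by rewrite -(dil1 R k0); apply: eqqW (le _) (eqq_dil k0 (gF m)).
apply: eqq_trans (eqqW (le _) (eqq_dil k0 (iprodE (n := n) gF))) _.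
by rewrite (big_morph (dil k) (dilM k0) (dil1 R k0)).
Qed.

Lemma iprod0 F : cf (iprod F) 0 = 1.
Proof. by rewrite /= big_ord0. Qed.

End InfiniteProduct.

Notation fz := (fps int).

Lemma cf_int (c : int) n : cf (c%:~R : fz) n = if n == 0%N then c else 0.
Proof.
case: c => k; first by rewrite -pmulrn cf_nat; case: ifP; rewrite // natz.
by rewrite NegzE mulrNz cfN -pmulrn cf_nat natz; case: ifP; rewrite ?oppr0.
Qed.

Lemma cf_intM (c : int) (a : fz) n : cf (c%:~R * a) n = c * cf a n.
Proof.
rewrite cfM big_ord_recl /= subn0 cf_int /= big1 ?addr0 // => i _.
by rewrite cf_int mul0r.
Qed.

(** * Gaussian binomial coefficients of odd order *)

Local Notation q := (qm 1 : fz).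

Definition poch n : fz := \prod_(i < n) (1 - qm i.+1).
Definition f1 : fz := iprod (fun m => 1 - qm m.+1).

Lemma pgood_f1 : pgood (fun m => 1 - qm m.+1 : fz).
Proof.
by move=> m i lei; rewrite cfB /= (ltn_eqF lei) subr0.
Qed.

Arguments poch n%_N.

Lemma f1_poch n : eqq n.+1 f1 (poch n).
Proof. exact/iprodE/pgood_f1. Qed.

Lemma cf_f1 : cf f1 0 = 1. Proof. exact: iprod0. Qed.

Lemma cf_poch n : cf (poch n) 0 = 1.
Proof. by rewrite -(@f1_poch n 0) ?cf_f1. Qed.

Lemma pochS n : poch n.+1 = poch n * (1 - qm n.+1).
Proof. by rewrite /poch big_ord_recr. Qed.

(* The Gaussian binomial coefficient of 2n+1 and n-k. *)
Definition gbin n k : fz :=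
  if (k <= n)%N
  then poch (2 * n).+1 * fps_inv (poch (n - k)) * fps_inv (poch (n + k).+1)
  else 0.

Arguments gbin n%_N k%_N.

Lemma gbinE n k : (k <= n)%N ->
  poch (n - k) * poch (n + k).+1 * gbin n k = poch (2 * n).+1.
Proof.
move=> le; rewrite /gbin le.
set a := poch (n - k); set b := poch (n + k).+1; set c := poch _.+1.
have -> : a * b * (c * fps_inv a * fps_inv b) =
          c * (a * fps_inv a) * (b * fps_inv b) by ring.
by rewrite !fps_invP ?cf_poch // !mulr1.
Qed.

Lemma gbin_gt n k : (n < k)%N -> gbin n k = 0.
Proof. by rewrite /gbin ltnNge => /negbTE->. Qed.

(** The index -1 is folded onto 0: the Gaussian binomials of [2n+1] over [n+1] and over [n]
    coincide. *)
Definition gbin_pred n k := if k is k'.+1 then gbin n k' else gbin n 0.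

(** Two steps of the q-Pascal rule at once, from [2n+1] to [2n+3]. It is checked after
    multiplication by the denominator [X] of [gbin n.+1 k], which clears all inverses. *)
Lemma gbin_rec n k : (k <= n.+1)%N ->
  gbin n.+1 k = (1 + qm (2 * n).+2) * gbin n k
    + qm (n.+1 - k) * gbin_pred n k + qm (n + k).+2 * gbin n k.+1.
Proof.
move=> le; pose X : fz := poch (n.+1 - k) * poch (n.+1 + k).+1.
have X0 : cf X 0 = 1 by rewrite cfM0 !cf_poch mulr1.
apply: (fps_mulI X0); rewrite {1}/X gbinE //.
have -> : (2 * n.+1).+1 = (2 * n).+3 by lia.
rewrite (pochS (2 * n).+2) (pochS (2 * n).+1) 2![in RHS]mulrDr.
set W := poch (2 * n).+1.
have q3 : qm (2 * n).+3 = q * qm (2 * n).+2 by rewrite -qmD.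
have hpred : X * gbin_pred n k = W * ((1 - qm (n + k).+1) * (1 - qm (n + k).+2)).
  case: k le @X X0 => [|k] le X X0 /=.
    rewrite /W -(gbinE (leq0n n)) /X subn0 !addn0 subn0.
    by rewrite !pochS; ring.
  rewrite /W -(gbinE (le : k <= n)%N) /X subSS addSn !addnS !pochS; ring.
case: (ltnP n k) => [lt|ge].
  have ek : k = n.+1 by apply/eqP; rewrite eqn_leq le.
  rewrite !gbin_gt ?(ltnW lt) // ?ltnS ?(ltnW lt) // !mulr0 add0r addr0.
  rewrite mulrCA hpred ek subnn qm0 mul1r q3 -!mulrA; congr (_ * _).
  have -> : (n + n.+1).+1 = (2 * n).+2 by lia.
  by rewrite q3.
have hk : X * gbin n k = W * ((1 - qm (n.+1 - k)) * (1 - qm (n + k).+2)).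
  by rewrite /W -(gbinE ge) /X subSn // addSn !pochS; ring.
have hsucc : X * gbin n k.+1 = W * ((1 - qm (n - k)) * (1 - qm (n.+1 - k))).
  move: ge; rewrite leq_eqVlt => /predU1P[->|lt].
    by rewrite gbin_gt // subnn qm0 subrr mul0r !mulr0.
  rewrite /W -(gbinE lt) /X addSn addnS subSn ?(ltnW lt) // pochS.
  by rewrite -(subnSK lt) pochS; ring.
rewrite 2!(mulrCA X (qm _)) hpred hsucc mulrCA hk.
have e1 : qm (n.+1 - k) = q * qm (n - k) by rewrite -qmD subSn.
have e2 : qm (n + k).+2 = q * qm (n + k).+1 by rewrite -qmD.
have e3 : qm (2 * n).+2 = q * (qm (n - k) * qm (n + k).+1).
  by rewrite -!qmD; congr qm; lia.
rewrite q3 e1 e2 e3; ring.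
Qed.

(** For growing [n] the Gaussian binomial tends to the inverse of [f1]; [th_lim] depends on this
    precision. *)
Lemma gbin_lim n k : (k <= n)%N -> eqq (n - k).+1 (f1 * gbin n k) 1.
Proof.
move=> le; set N := (n - k).+1.
have h m : (n - k <= m)%N -> eqq N f1 (poch m).
  by move=> hm; apply: (eqqW _ (@f1_poch m)).
have p0 m := fps_invP (cf_poch m).
have step : eqq N (f1 * (f1 * gbin n k)) (f1 * 1).
  rewrite mulrA mulr1; apply: eqq_trans (_ : eqq N _ (poch (2 * n).+1)) _.
    rewrite -(gbinE le); apply: eqqM => //; apply: eqqM; apply: h => //; lia.
  by apply/eqq_sym/h; lia.
have := eqqM (eqq_refl N (fps_inv f1)) step.
by rewrite !mulrA [fps_inv _ * _]mulrC fps_invP ?cf_f1 // !mul1r.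
Qed.

Definition tri k := 'C(k.+1, 2).

Arguments tri k%_N.

Lemma triS k : tri k.+1 = (tri k + k.+1)%N.
Proof. by rewrite /tri binS bin1. Qed.

Lemma tri_ge k : (k <= tri k)%N.
Proof. by elim: k => // k IH; rewrite triS; lia. Qed.

Lemma tri2 k : (2 * tri k = k * k.+1)%N.
Proof. by elim: k => // k IH; rewrite triS mulnDr IH; lia. Qed.

Definition tsgn k : fz := (-1) ^+ k * qm (tri k).

Lemma tsgn0 : tsgn 0 = 1.
Proof. by rewrite /tsgn /= qm0 mulr1. Qed.

Lemma tsgnS k : tsgn k.+1 = - (qm k.+1 * tsgn k).
Proof. by rewrite /tsgn exprS triS qmD; ring. Qed.

(** * The finite triple product in symmetric form *)

Local Notation fzX := {poly fz}.

(** With [X = z + 1/z], the first component is the sum of the [z^j] for [-k <= j <= k]. The second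
    one is its predecessor, which the recurrence forces to be -1 at the index -1. *)
Fixpoint cheb2 k : fzX * fzX :=
  if k is k'.+1 then let: (a, b) := cheb2 k' in ('X * a - b, a)
  else (1, -1).

Definition cheb k := (cheb2 k).1.

Lemma cheb0 : cheb 0 = 1. Proof. by []. Qed.
Lemma cheb1 : cheb 1 = 'X + 1.
Proof. by rewrite /cheb /= mulr1 opprK. Qed.
Lemma chebSS k : cheb k.+2 = 'X * cheb k.+1 - cheb k.
Proof.
have E j : cheb2 j.+1 = ('X * (cheb2 j).1 - (cheb2 j).2, (cheb2 j).1).
  by rewrite /=; case: (cheb2 j).
by rewrite /cheb !E.
Qed.

Definition thprod n : fzX :=
  \prod_(i < n) (1 - (qm i.+1)%:P * 'X + (qm (2 * i.+1))%:P).

Lemma X_cheb k :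
  'X * cheb k = cheb k.+1 + (if k is k'.+1 then cheb k' else -1).
Proof. by case: k => [|k]; rewrite ?cheb1 ?cheb0 ?chebSS; ring. Qed.

(** For [X = z + 1/z] the factors of [thprod] are [(1 - z q^i)(1 - q^i / z)]. In the induction the
    new factor is [1 + q^(2n+2) - q^(n+1) X]; [X_cheb] turns [X] into the two shifts of [k], and
    these match the three terms of [gbin_rec]. *)
Lemma thprodE n :
  thprod n = \sum_(k < n.+1) (tsgn k * gbin n k)%:P * cheb k.
Proof.
elim: n => [|n IH].
  rewrite /thprod big_ord0 big_ord1 cheb0 mulr1 /gbin /= /poch !big_ord_recl.
  rewrite !big_ord0 tsgn0 !mulr1 mul1r.
  have c0 : cf (1 - q : fz) 0 = 1 by rewrite cfB cf1 /= subr0.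
  have -> : fps_inv (1 : fz) = 1.
    by have := @fps_invP _ (1 : fz) erefl; rewrite mul1r.
  by rewrite mulr1 fps_invP.
rewrite /thprod big_ord_recr /= -/(thprod n) {}IH.
pose A k := (tsgn k)%:P * cheb k.
have S1 : \sum_(k < n.+2) A k * (gbin n k)%:P = \sum_(k < n.+1) A k * (gbin n k)%:P.
  by rewrite big_ord_recr /= gbin_gt // polyC0 mulr0 addr0.
(* The sum is reindexed by [k + 1]. Its term at 0 comes from the fold in [gbin_pred] and cancels
   against the one in [S3]. *)
have S2 : \sum_(k < n.+2) A k * (qm (n.+1 - k) * gbin_pred n k)%:P =
    (qm n.+1 * gbin n 0)%:P -
    \sum_(k < n.+1) (qm n.+1 * tsgn k * gbin n k)%:P * cheb k.+1.
  rewrite big_ord_recl /= subn0 /A cheb0 tsgn0 mulr1 mul1r; congr (_ + _).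
  rewrite -sumrN; apply: eq_bigr => k _; rewrite /bump /= !add1n subSS.
  rewrite tsgnS.
  have -> : qm n.+1 = qm k.+1 * qm (n - k) :> fz.
    by rewrite -qmD; congr qm; have := ltn_ord k; lia.
  by rewrite !polyCM polyCN !polyCM; ring.
have S3 : \sum_(k < n.+2) A k * (qm (n + k).+2 * gbin n k.+1)%:P =
    - (qm n.+1 * gbin n 0)%:P -
    \sum_(k < n.+1) (qm n.+1 * tsgn k * gbin n k)%:P *
       (if nat_of_ord k is k'.+1 then cheb k' else -1).
  rewrite 2!big_ord_recr /= (gbin_gt (ltnSn n)) (gbin_gt (leqnSn n.+1)).
  rewrite !mulr0 ?polyC0 ?mulr0 !addr0.
  rewrite [in RHS]big_ord_recl /= tsgn0 mulr1.
  rewrite mulrN1 opprD opprK addrA addNr add0r -sumrN.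
  apply: eq_bigr => k _; rewrite /A /bump /= add1n tsgnS.
  have -> : qm (n + k).+2 = qm n.+1 * qm k.+1 :> fz.
    by rewrite -qmD; congr qm; lia.
  by rewrite !polyCM polyCN !polyCM; ring.
rewrite [RHS](_ : _ = \sum_(k < n.+2) ((1 + qm (2 * n).+2)%:P * (A k * (gbin n k)%:P)
   + (A k * (qm (n.+1 - k) * gbin_pred n k)%:P
   + A k * (qm (n + k).+2 * gbin n k.+1)%:P))); last first.
  apply: eq_bigr => k _; rewrite gbin_rec -1?ltnS // /A.
  by rewrite !(polyCM, polyCD); ring.
rewrite !big_split /= -mulr_sumr S1 S2 S3.
have -> : qm (2 * n.+1) = qm (2 * n).+2 :> fz by congr qm; lia.
set c := (_ * gbin n 0)%:P; set a := \sum_(k < n.+1) _ * cheb k.+1.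
set b := \sum_(k < n.+1) _ * (if _ is _.+1 then _ else _).
have -> : \sum_(k < n.+1) (tsgn k * gbin n k)%:P * cheb k =
          \sum_(k < n.+1) A k * (gbin n k)%:P.
  by apply: eq_bigr => k _; rewrite /A polyCM; ring.
have eab : a + b = 'X * (qm n.+1)%:P * \sum_(k < n.+1) A k * (gbin n k)%:P.
  rewrite /a /b -big_split mulr_sumr; apply: eq_bigr => k _.
  by rewrite /= -mulrDr -X_cheb /A !polyCM; ring.
have -> : c - a + (- c - b) = - (a + b) by ring.
by rewrite eab !polyCD; ring.
Qed.

(** * Theta series indexed by triangular numbers *)

Definition th (u : nat -> int) : fz :=
  Fps (fun N => \sum_(k < N.+1 | tri k == N) u k).

Lemma thE u n : eqq n.+1 (th u) (\sum_(k < n.+1) (u k)%:~R * qm (tri k)).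
Proof.
move=> i lei; rewrite cf_sum [LHS]/=.
rewrite (big_ord_widen_cond n.+1 (fun k => tri k == i) u) //.
rewrite [LHS]big_mkcond; apply: eq_bigr => k _; rewrite cf_intM /=.
rewrite [i == _]eq_sym; case: eqP => [e|_]; last by rewrite mulr0.
by rewrite mulr1 ltnS -e tri_ge.
Qed.

(** The linear map [ev] will be evaluation at an integer and also the derivative at 1. Since
    [tri k >= k], the factor [qm (tri k)] lifts the precision [n - k + 1] of [gbin_lim] to [n + 1]
    for every [k]. *)
Lemma th_lim (v : nat -> int) (ev : fzX -> fz) :
  (forall p r, ev (p + r) = ev p + ev r) ->
  (forall c p, ev (c%:P * p) = c * ev p) ->
  (forall k, ev (cheb k) = (v k)%:~R) ->
  forall n, eqq n.+1 (f1 * ev (thprod n)) (th (fun k => (-1) ^+ k * v k)).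
Proof.
move=> evD evM evC n; apply: eqq_trans (eqq_sym (@thE _ n)).
have ev0 : ev 0 = 0 by rewrite -[0](mul0r 0) -polyC0 evM mul0r.
rewrite thprodE (big_morph ev evD ev0) mulr_sumr; apply: eqq_sum => k _.
rewrite evM evC /tsgn intrM rmorphXn rmorphN1.
set m1 := (-1) ^+ k; set w := (v k)%:~R.
have -> : f1 * (m1 * qm (tri k) * gbin n k * w) =
          m1 * w * (qm (tri k) * (f1 * gbin n k)) by ring.
apply: eqqM => //; rewrite -[X in eqq _ _ X]mulr1.
have le := ltn_ord k; rewrite ltnS in le.
apply: (@eqqW _ _ (tri k + (n - k).+1)); first by have := tri_ge k; lia.
exact/eqq_qmM/gbin_lim.
Qed.

Local Close Scope ring_scope.

(** * Enumeration of partitions with designated summands *)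

Definition des_le M n s := designated n s && all (geq M) (unzip1 s).

(* The invariant of the enumeration while the parts of size [M] are listed:
   [c] is the number of tags that they still have to receive. *)
Definition des_top M c n (s : seq (nat * bool)) :=
  [&& sorted geq (unzip1 s), 0 \notin unzip1 s, sumn (unzip1 s) == n,
      all (geq M) (unzip1 s), count_mem (M, true) s == c
    & all (fun j => (j < M) ==> (count_mem (j, true) s == 1)) (unzip1 s)].

Lemma count_mem_unzip1 (s : seq (nat * bool)) j b :
  j \notin unzip1 s -> count_mem (j, b) s = 0.
Proof.
move=> js; apply/count_memPn; apply: contra js => js.
by apply/mapP; exists (j, b).
Qed.

(** A head of the largest allowed size imposes no further order condition, and its tag is charged to
    [c]. *)
Lemma des_top_cons m c n b s :
  des_top m.+1 c n ((m.+1, b) :: s) =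
  [&& m.+1 <= n, b <= c & des_top m.+1 (c - b) (n - m.+1) s].
Proof.
have tr : transitive geq by move=> x y z /= h1 h2; apply: leq_trans h2 h1.
rewrite /des_top /= path_sortedE //= inE /= leqnn ltnn /=.
set u := unzip1 s.
have -> : all (fun j => (j < m.+1) ==>
    (((m.+1, b) == (j, true)) + count_mem (j, true) s == 1)) u =
  all (fun j => (j < m.+1) ==> (count_mem (j, true) s == 1)) u.
  apply: eq_all => j; case: ltnP => // lt.
  have -> : ((m.+1, b) == (j, true)) = false.
    by apply/eqP => -[e]; rewrite e ltnn in lt.
  by [].
have -> : ((m.+1, b) == (m.+1, true)) = b by rewrite xpair_eqE eqxx; case: b.
have e1 : (m.+1 + sumn u == n) = (m.+1 <= n) && (sumn u == n - m.+1).
  by apply/eqP/andP => [<-|[le /eqP->]]; rewrite ?addKn ?leq_addr ?subnKC.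
have e2 k : (b + k == c) = (b <= c) && (k == c - b).
  by apply/eqP/andP => [<-|[le /eqP->]]; rewrite ?addKn ?leq_addr ?subnKC.
rewrite e1 e2.
case: (m.+1 <= n); case: (b <= c); rewrite ?andbF ?andbT //=.
by case: (all (geq m.+1) u); rewrite ?andbF //= andbA.
Qed.

Lemma des_top_le m c n s : all (geq m) (unzip1 s) ->
  des_top m.+1 c n s = (c == 0) && des_le m n s.
Proof.
move=> le; rewrite /des_top /des_le /designated le andbT.
have -> : all (geq m.+1) (unzip1 s).
  by apply: sub_all le => j /= /leqW.
rewrite count_mem_unzip1 ?[0 == c]eq_sym; last first.
  by apply/negP => /(allP le) /=; rewrite ltnn.
have -> : all (fun j => (j < m.+1) ==> (count_mem (j, true) s == 1)) (unzip1 s) =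
          all (fun j => count_mem (j, true) s == 1) (unzip1 s).
  by apply: eq_in_all => j /(allP le) /= jm; rewrite ltnS jm.
by case: (c == 0); rewrite ?andbF.
Qed.

(** Either the size [m.+1] does not occur, or it occurs and carries exactly one tag; [enumS] follows
    this dichotomy. *)
Lemma des_le_top m n s :
  des_le m.+1 n s = des_le m n s || des_top m.+1 1 n s.
Proof.
have [le|nle] := boolP (all (geq m) (unzip1 s)).
  rewrite des_top_le //= orbF /des_le le.
  by have -> : all (geq m.+1) (unzip1 s) by apply: sub_all le => j /= /leqW.
rewrite {2}/des_le (negbTE nle) andbF /=.
rewrite /des_le /designated /des_top -!andbA.
case: (boolP (sorted _ _)) => //= so; case: (0 \in _) => //=.
case: (sumn _ == n) => //=; rewrite andbC.
case: (boolP (all (geq m.+1) _)) => //= le.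
have mem : m.+1 \in unzip1 s.
  case/allPn: nle => j js; rewrite /= -ltnNge => jm.
  have := allP le _ js; rewrite /= => jm'.
  by have <- : j = m.+1 by apply/eqP; rewrite eqn_leq jm jm'.
apply/idP/andP => [h|[h1 h2]].
  split; first exact: (allP h _ mem).
  by apply: sub_all h => j ->; rewrite implybT.
apply/allP => j js; have := allP h2 _ js; have := allP le _ js.
by rewrite /= leq_eqVlt => /predU1P[-> _|->].
Qed.

Lemma des_head m (s : seq (nat * bool)) : sorted geq (unzip1 s) -> all (geq m.+1) (unzip1 s) ->
  ~~ all (geq m) (unzip1 s) -> exists b t, s = (m.+1, b) :: t.
Proof.
have tr : transitive geq by move=> x y z /= h1 h2; apply: leq_trans h2 h1.
case: s => [//|[p b] s] /=; rewrite path_sortedE // => /andP[ps _] /andP[pm _].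
move=> h; exists b, s; congr ((_, _) :: _); apply/eqP; rewrite eqn_leq pm /=.
rewrite ltnNge; apply: contra h => pm'; rewrite pm' /=.
by apply: sub_all ps => j /= jp; apply: leq_trans jp pm'.
Qed.

Lemma des_top_head m c n s : des_top m.+1 c n s ->
  ~~ all (geq m) (unzip1 s) -> exists b t, s = (m.+1, b) :: t.
Proof. by case/and5P => so _ _ le _; apply: des_head. Qed.

Section Step.
Variables (m : nat) (E : nat -> seq (seq (nat * bool))).

(** [enumD] prepends untagged parts [m.+1] only, [enumB] still has one tag to place on them. The
    argument [k] is fuel, which by [enumD_fuel] has no influence once it is at least [n]. *)
Fixpoint enumD k n : seq (seq (nat * bool)) :=
  E n ++ if k is k'.+1 then
    if m.+1 <= n then map (cons (m.+1, false)) (enumD k' (n - m.+1)) else [::]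
  else [::].

Fixpoint enumB k n : seq (seq (nat * bool)) :=
  if k is k'.+1 then
    if m.+1 <= n then map (cons (m.+1, true)) (enumD k' (n - m.+1)) ++
                      map (cons (m.+1, false)) (enumB k' (n - m.+1))
    else [::]
  else [::].

Definition enumS n := E n ++ enumB n n.

Lemma enumD_fuel k k' n : n <= k -> n <= k' -> enumD k n = enumD k' n.
Proof.
elim: k k' n => [|k IH] [|k'] [|n] //= nk nk'.
by case: ifP => // h; rewrite subSS (IH k') //; lia.
Qed.

Lemma enumB_fuel k k' n : n <= k -> n <= k' -> enumB k n = enumB k' n.
Proof.
elim: k k' n => [|k IH] [|k'] [|n] //= nk nk'.
by case: ifP => // h; rewrite subSS (IH k') ?(@enumD_fuel k k') //; lia.
Qed.

Hypothesis E_uniq : forall n, uniq (E n).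
Hypothesis E_mem : forall n s, (s \in E n) = des_le m n s.

Lemma mem_cons_map (x : nat * bool) t (l : seq (seq (nat * bool))) (y : nat * bool) :
  (x :: t \in map (cons y) l) = (x == y) && (t \in l).
Proof.
apply/mapP/andP => [[t' t'l [-> ->]]|[/eqP-> tl]]; first by rewrite eqxx.
by exists t.
Qed.

Lemma map_cons_le y (l : seq (seq (nat * bool))) s :
  s \in map (cons (m.+1, y)) l -> ~~ all (geq m) (unzip1 s).
Proof. by case/mapP => t _ -> /=; rewrite ltnn. Qed.

Lemma E_le n (s : seq (nat * bool)) : s \in E n -> all (geq m) (unzip1 s).
Proof. by rewrite E_mem => /andP[]. Qed.

Lemma enumD_mem k n s : n <= k -> (s \in enumD k n) = des_top m.+1 0 n s.
Proof.
elim: k n s => [|k IH] n s nk.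
  move: nk; rewrite leqn0 => /eqP -> /=; rewrite cats0 E_mem.
  have [le|nle] := boolP (all (geq m) (unzip1 s)); first by rewrite des_top_le.
  rewrite /des_le (negbTE nle) andbF; apply/esym/negbTE/negP => h.
  have [b [t es]] := des_top_head h nle; move: h.
  by rewrite es des_top_cons.
rewrite [enumD _ _]/= mem_cat E_mem.
have [le|nle] := boolP (all (geq m) (unzip1 s)).
  rewrite des_top_le //=; case: ifP => _; rewrite ?in_nil ?orbF //.
  by rewrite (contraTF (@map_cons_le _ _ _)) ?orbF ?le.
rewrite /des_le (negbTE nle) andbF /=.
apply/idP/idP => [|h].
  case: ifP => // le /mapP[t tE es]; rewrite es des_top_cons le /=.
  by rewrite subn0 -IH //; lia.
have [b [t es]] := des_top_head h nle; move: h; rewrite es des_top_cons.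
case: b es => [|] es; rewrite ?andbF // => /and3P[-> _ h].
by rewrite mem_cons_map eqxx IH //; lia.
Qed.

Lemma des_top1_le n s : des_top m.+1 1 n s -> ~~ all (geq m) (unzip1 s).
Proof. by move=> h; apply/negP => le; rewrite des_top_le in h. Qed.

Lemma enumB_mem k n s : n <= k -> (s \in enumB k n) = des_top m.+1 1 n s.
Proof.
elim: k n s => [|k IH] n s nk.
  move: nk; rewrite leqn0 => /eqP -> /=; rewrite in_nil.
  apply/esym/negbTE/negP => h.
  have [b [t es]] := des_top_head h (des_top1_le h); move: h.
  by rewrite es des_top_cons.
apply/idP/idP => [|h] /=.
  case: ifP => // le; rewrite mem_cat => /orP[] /mapP[t tE ->];
    rewrite des_top_cons le /=.
    by rewrite -(@enumD_mem k) //; lia.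
  by rewrite subn0 -IH //; lia.
have [b [t es]] := des_top_head h (des_top1_le h); move: h.
rewrite es des_top_cons.
case: b es => [|] es /and3P[-> _ h]; rewrite mem_cat !mem_cons_map eqxx /=.
  by rewrite enumD_mem ?h //; lia.
by rewrite IH ?h ?orbT //; lia.
Qed.

Lemma cons_inj (x : nat * bool) : injective (cons x).
Proof. by move=> s t []. Qed.

Lemma enumD_uniq k n : uniq (enumD k n).
Proof.
elim: k n => [|k IH] n /=; first by rewrite cats0.
case: ifP => _; last by rewrite cats0.
rewrite cat_uniq E_uniq map_inj_uniq ?IH ?andbT /=; last exact: cons_inj.
by apply/hasPn => s /map_cons_le; apply: contra; apply: E_le.
Qed.

Lemma enumB_uniq k n : uniq (enumB k n).
Proof.
elim: k n => [|k IH] n //=; case: ifP => // _.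
rewrite cat_uniq !map_inj_uniq ?enumD_uniq ?IH ?andbT /=; try exact: cons_inj.
by apply/hasPn => s /mapP[t _ ->]; apply/negP => /mapP[t' _] [].
Qed.

Lemma enumS_mem n s : (s \in enumS n) = des_le m.+1 n s.
Proof. by rewrite mem_cat E_mem enumB_mem // des_le_top. Qed.

Lemma enumS_uniq n : uniq (enumS n).
Proof.
rewrite cat_uniq E_uniq enumB_uniq andbT /=.
apply/hasPn => s; rewrite enumB_mem //; apply: contraTN => /E_le le.
by rewrite des_top_le.
Qed.
End Step.

Fixpoint enumP M : nat -> seq (seq (nat * bool)) :=
  if M is m.+1 then enumS m (enumP m)
  else fun n => if n == 0 then [:: [::]] else [::].

Lemma enumPP M : (forall n, uniq (enumP M n)) /\
  (forall n s, (s \in enumP M n) = des_le M n s).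
Proof.
elim: M => [|m [IHu IHm]].
  split=> [[|n] //|n s]; rewrite [enumP 0 n]/=.
  case: s => [|[p b] s]; first by case: n => [|n]; rewrite ?inE.
  have -> : ((p, b) :: s \in (if n == 0 then [:: [::]] else [::])) = false.
    by case: (n == 0); rewrite ?inE.
  apply/esym/negbTE/negP; rewrite /des_le /designated /= inE.
  by case/andP => /and4P[_ /norP[p0 _] _ _]; case: p p0.
split=> n; first exact: enumS_uniq.
exact: enumS_mem.
Qed.

Lemma PDt_enum M n : n <= M -> PDt n = \sum_(s <- enumP M n) count snd s.
Proof.
move=> nM; rewrite [PDt n](_ : _ = \sum_(s <- [seq tparts_seq t |
  t <- index_enum (tparts n) & designated n (tparts_seq t)]) count snd s);
  last by rewrite big_map big_filter.
apply: perm_big; have [hu hm] := enumPP M; apply: uniq_perm; last move=> s.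
- by rewrite map_inj_uniq ?filter_uniq ?index_enum_uniq //; exact: tparts_seq_inj.
- exact: hu.
rewrite hm; apply/mapP/andP => [[t]|[d _]].
  rewrite mem_filter => /andP[d _] ->; split => //.
  apply/allP => j /mapP[x /mapP[y _ ->]] -> /=.
  by apply: leq_trans nM; rewrite -ltnS ltn_ord.
have [t et] := designated_tparts d.
by exists t => //; rewrite mem_filter et d mem_index_enum.
Qed.

(** * Generating series of the enumeration *)

Local Open Scope ring_scope.

Definition nser (E : nat -> seq (seq (nat * bool))) : fz :=
  Fps (fun n => (size (E n))%:R).
Definition tser (E : nat -> seq (seq (nat * bool))) : fz :=
  Fps (fun n => (\sum_(s <- E n) count snd s)%:R).

Section StepSeries.
Variables (m : nat) (E : nat -> seq (seq (nat * bool))).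
Let x : fz := qm m.+1.
Let D n := enumD m E n n.
Let B n := enumB m E n n.

Lemma sum_map_cons (y : nat * bool) (l : seq (seq (nat * bool))) :
  (\sum_(s <- map (cons y) l) count snd s =
   y.2 * size l + \sum_(s <- l) count snd s)%N.
Proof.
elim: l => [|s l IH] /=; first by rewrite !big_nil muln0.
by rewrite !big_cons IH /=; lia.
Qed.

Lemma DE n : D n = E n ++
  if (m.+1 <= n)%N then map (cons (m.+1, false)) (D (n - m.+1)%N) else [::].
Proof.
rewrite {1}/D; case: n => [//|n]; rewrite [enumD _ _ _ _]/=; congr (_ ++ _).
by case: ifP => // h; rewrite (@enumD_fuel _ _ n (n.+1 - m.+1)%N) //; lia.
Qed.

Lemma BE n : B n =
  if (m.+1 <= n)%N then map (cons (m.+1, true)) (D (n - m.+1)%N) ++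
    map (cons (m.+1, false)) (B (n - m.+1)%N) else [::].
Proof.
rewrite {1}/B; case: n => [//|n]; rewrite [enumB _ _ _ _]/=.
by case: ifP => // h; rewrite (@enumD_fuel _ _ n (n.+1 - m.+1)%N) ?(@enumB_fuel _ _ n (n.+1 - m.+1)%N) //; lia.
Qed.

Lemma nserD : (1 - x) * nser D = nser E.
Proof.
suff e : nser D = nser E + x * nser D by rewrite mulrBl mul1r {1}e addrK.
apply: fpsP => n; rewrite cfD cf_qmM [LHS]/= DE size_cat natrD.
by case: ifP => _; rewrite ?size_map.
Qed.

Lemma tserD : (1 - x) * tser D = tser E.
Proof.
suff e : tser D = tser E + x * tser D by rewrite mulrBl mul1r {1}e addrK.
apply: fpsP => n; rewrite cfD cf_qmM [LHS]/= DE big_cat natrD.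
by case: ifP => _; rewrite ?sum_map_cons ?big_nil.
Qed.

Lemma nserB : (1 - x) * nser B = x * nser D.
Proof.
suff e : nser B = x * nser D + x * nser B by rewrite mulrBl mul1r {1}e addrK.
rewrite -mulrDr; apply: fpsP => n; rewrite cf_qmM [LHS]/= BE.
by case: ifP => // _; rewrite cfD size_cat !size_map natrD.
Qed.

(** The summand [nser D] accounts for the tag on the head itself. *)
Lemma tserB : (1 - x) * tser B = x * (tser D + nser D).
Proof.
suff e : tser B = x * (tser D + nser D) + x * tser B.
  by rewrite mulrBl mul1r {1}e addrK.
rewrite -mulrDr; apply: fpsP => n; rewrite cf_qmM [LHS]/= BE.
case: ifP => [_|_]; last by rewrite big_nil.
rewrite !cfD big_cat !sum_map_cons /= mul1n mul0n add0n !natrD.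
by rewrite [(size _)%:R + _]addrC.
Qed.

(** A part size contributes [1 + x / (1 - x)^2 = (1 - x + x^2) / (1 - x)^2], whose numerator is a
    factor of [thprod] at [X = 1]. *)
Lemma nserS : (1 - x) ^+ 2 * nser (enumS m E) = (1 - x + x ^+ 2) * nser E.
Proof.
have -> : nser (enumS m E) = nser E + nser B.
  by apply: fpsP => n; rewrite cfD /= size_cat natrD.
have -> : (1 - x) ^+ 2 * (nser E + nser B) =
  (1 - x) ^+ 2 * nser E + (1 - x) * ((1 - x) * nser B) by ring.
have -> : (1 - x) * ((1 - x) * nser B) = x * ((1 - x) * nser D).
  by rewrite nserB; ring.
by rewrite nserD; ring.
Qed.

Lemma tserS : (1 - x) ^+ 2 * tser (enumS m E) =
  (1 - x + x ^+ 2) * tser E + x * nser E.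
Proof.
have -> : tser (enumS m E) = tser E + tser B.
  by apply: fpsP => n; rewrite cfD /= big_cat natrD.
have -> : (1 - x) ^+ 2 * (tser E + tser B) =
  (1 - x) ^+ 2 * tser E + (1 - x) * ((1 - x) * tser B) by ring.
have -> : (1 - x) * ((1 - x) * tser B) = x * ((1 - x) * tser D + (1 - x) * nser D).
  by rewrite tserB; ring.
by rewrite nserD tserD; ring.
Qed.
End StepSeries.

Lemma thprodS M : thprod M.+1 =
  thprod M * (1 - (qm M.+1)%:P * 'X + (qm M.+1 ^+ 2)%:P).
Proof.
rewrite /thprod big_ord_recr /=; do !congr (_ * _); congr (_ + _%:P).
by rewrite qmX mulnC.
Qed.

(** Counting tags is differentiation: minus the derivative of [1 - x X + x^2] in [X] is [x], the
    coefficient of the extra term in [tserS], so that this recurrence is the product rule. *)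
Lemma enumP_thprod M :
  poch M ^+ 2 * nser (enumP M) = (thprod M).[1] /\
  poch M ^+ 2 * tser (enumP M) = - (thprod M)^`().[1].
Proof.
elim: M => [|M [IHn IHt]].
  have -> : thprod 0 = 1 by rewrite /thprod big_ord0.
  rewrite /poch big_ord0 expr1n !mul1r hornerC; split.
    by apply: fpsP => -[|n].
  by rewrite derivC horner0 oppr0; apply: fpsP => -[|n] /=;
    rewrite ?big_cons big_nil.
have -> : enumP M.+1 = enumS M (enumP M) by [].
rewrite thprodS pochS !exprMn -!(mulrA (poch M ^+ 2)) nserS tserS.
split.
  by rewrite mulrCA IHn hornerM !hornerE; ring.
rewrite [LHS](_ : _ = (1 - qm M.+1 + qm M.+1 ^+ 2) *
  (poch M ^+ 2 * tser (enumP M)) + qm M.+1 * (poch M ^+ 2 * nser (enumP M)));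
  last by ring.
rewrite IHn IHt derivM !derivD !derivN derivM !derivC derivX !hornerE; ring.
Qed.

Definition PDtser : fz := Fps (fun n => (PDt n)%:R).

Lemma PDtser_lim M : eqq M.+1 PDtser (tser (enumP M)).
Proof. by move=> n nM /=; rewrite (PDt_enum (nM : n <= M)%N). Qed.

(** Values and derivatives at 1 of the two components of [cheb2], from the differentiated
    recurrence. *)
Fixpoint dcheb2 k : (int * int) * (int * int) :=
  if k is k'.+1 then
    let: ((u, u'), (d, d')) := dcheb2 k' in ((u - u', u), (u + d - d', d))
  else ((1, -1), (0, 0)).
Definition dcheb k := (dcheb2 k).2.1.

Lemma deriv_cheb k : (cheb k)^`().[1] = (dcheb k)%:~R.
Proof.
suff : [/\ (cheb2 k).1.[1] = ((dcheb2 k).1.1)%:~R,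
  (cheb2 k).2.[1] = ((dcheb2 k).1.2)%:~R,
  (cheb2 k).1^`().[1] = ((dcheb2 k).2.1)%:~R &
  (cheb2 k).2^`().[1] = ((dcheb2 k).2.2)%:~R] by case.
elim: k => [|k].
  by split; rewrite /= ?derivN -?polyC1 ?derivC ?hornerN ?hornerC ?oppr0 ?rmorphN1.
rewrite [cheb2 k.+1]/= [dcheb2 k.+1]/=; case: (cheb2 k) => a b.
case: (dcheb2 k) => -[u u'] [d d'] [/= ea eb ea' eb'].
split; rewrite /= ?derivB ?derivM ?derivX ?hornerE ?ea ?eb ?ea' ?eb';
  rewrite ?rmorphB ?rmorphD /=; ring.
Qed.

(* This is the derivative at [y = 1] of [triple_product]. *)
Lemma PDtser_f1 : f1 ^+ 3 * PDtser = th (fun k => - ((-1) ^+ k * dcheb k)).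
Proof.
apply: eqq_all => N; apply: (@eqqW _ _ N.+1) => //.
have evM (c : fz) (p : {poly fz}) : (c%:P * p)^`().[1] = c * p^`().[1].
  by rewrite derivM derivC mul0r add0r hornerM hornerC.
have evD (p r : {poly fz}) : (p + r)^`().[1] = p^`().[1] + r^`().[1].
  by rewrite derivD hornerD.
have := th_lim (n := N) evD evM deriv_cheb; move/eqqN => h.
have -> : th (fun k => - ((-1) ^+ k * dcheb k)) = - th (fun k => (-1) ^+ k * dcheb k).
  by apply: fpsP => n; rewrite cfN /= -sumrN.
apply: eqq_trans h; rewrite -mulrN -(enumP_thprod N).2 exprS -mulrA.
apply: eqqM => //; apply: eqqM; last exact: PDtser_lim.
exact/eqqX/f1_poch.
Qed.

(** * Values of the triple product at integers *)

Fixpoint icheb2 (y : int) k : int * int :=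
  if k is k'.+1 then let: (a, b) := icheb2 y k' in (y * a - b, a) else (1, -1).
Definition icheb y k := (icheb2 y k).1.

Lemma horner_cheb y k : (cheb k).[y%:~R] = (icheb y k)%:~R.
Proof.
suff : (cheb2 k).1.[y%:~R] = ((icheb2 y k).1)%:~R /\
       (cheb2 k).2.[y%:~R] = ((icheb2 y k).2)%:~R by case.
elim: k => [|k].
  by split; rewrite /= ?hornerN -?polyC1 ?hornerC ?rmorphN1.
rewrite [cheb2 k.+1]/= [icheb2 y k.+1]/=; case: (cheb2 k) => a b.
case: (icheb2 y k) => u v [/= ea eb].
by split; rewrite /= ?hornerE ?ea ?eb // rmorphB rmorphM.
Qed.

Lemma pgood_quad (y : int) : pgood (fun m => 1 - y%:~R * qm m.+1 + qm (2 * m.+1) : fz).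
Proof.
move=> m i lei; rewrite cfD cfB cf_intM /= (ltn_eqF lei) mulr0 subr0.
by case: eqP => [e|_]; rewrite ?addr0 //; lia.
Qed.

Lemma triple_product (y : int) :
  f1 * iprod (fun m => 1 - y%:~R * qm m.+1 + qm (2 * m.+1)) =
  th (fun k => (-1) ^+ k * icheb y k).
Proof.
apply: eqq_all => N; apply: (@eqqW _ _ N.+1) => //.
have evM (c : fz) (p : {poly fz}) : (c%:P * p).[y%:~R] = c * p.[y%:~R].
  by rewrite hornerM hornerC.
have evD (p r : {poly fz}) : (p + r).[y%:~R] = p.[y%:~R] + r.[y%:~R].
  by rewrite hornerD.
apply: eqq_trans (th_lim (n := N) evD evM (horner_cheb y)); apply: eqqM => //.
apply: eqq_trans (iprodE (pgood_quad y)) _.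
rewrite /thprod horner_prod (_ : \prod_(m < N) _ = \prod_(i < N)
  (1 - (qm i.+1)%:P * 'X + (qm (2 * i.+1))%:P).[y%:~R]) //.
by apply: eq_bigr => i _; rewrite !hornerE mulrC.
Qed.

(** * Product formulas *)

Definition f k : fz := dil k f1.
Arguments f k%_N.

Lemma f_1 : f 1 = f1. Proof. exact: dil_id. Qed.
Lemma cf_f k : (0 < k)%N -> cf (f k) 0 = 1.
Proof. by move=> k0; rewrite cf_dil_gt0 ?cf_f1. Qed.
Lemma dil_f k m : (0 < k)%N -> (0 < m)%N -> dil k (f m) = f (k * m).
Proof. by move=> *; rewrite /f dil_dil. Qed.

Definition psi : fz := th (fun _ => 1).

Definition fplus : fz := iprod (fun m => 1 + qm m.+1).

Lemma pgood_fplus : pgood (fun m => 1 + qm m.+1 : fz).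
Proof. by move=> m i lei; rewrite cfD /= (ltn_eqF lei) addr0. Qed.

Lemma fplusM : fplus * f1 = f 2.
Proof.
rewrite /f /f1 /fplus (iprod_dil _ pgood_f1) // (iprodM pgood_fplus pgood_f1).
apply: eq_iprod => m; rewrite dilB dil1 // dil_qm // mul2n -addnn qmD; ring.
Qed.

Lemma sqr_sign k : (-1) ^+ k * (-1) ^+ k = 1 :> int.
Proof. by rewrite -expr2 sqrr_sign. Qed.

(** At [y = -2] the factors are the squares [(1 + q^m)^2] and all signs in the theta series
    cancel. *)
Lemma psi_f1 : psi * f1 = f 2 ^+ 2.
Proof.
have ic k : icheb2 (-2) k = ((-1) ^+ k, - (-1) ^+ k).
  by elim: k => //= k ->; rewrite exprS; congr (_, _); ring.
have -> : psi = f1 * (fplus * fplus).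
  rewrite (_ : psi = th (fun k => (-1) ^+ k * icheb (-2) k)); last first.
    by congr th; apply: funext => k; rewrite /icheb ic sqr_sign.
  rewrite -triple_product /fplus (iprodM pgood_fplus pgood_fplus).
  congr (_ * _); apply: eq_iprod => m; rewrite mul2n -addnn qmD rmorphN /=; ring.
by rewrite -fplusM; ring.
Qed.

(** Jacobi's identity, the case [y = 2]. *)
Lemma f1_cubed : f1 ^+ 3 = th (fun k => (-1) ^+ k * (2 * k%:Z + 1)).
Proof.
have ic k : icheb2 2 k = (2 * k%:Z + 1, 2 * k%:Z - 1).
  elim: k => //= k ->; have -> : k.+1%:Z = k%:Z + 1 by lia.
  by congr (_, _); ring.
rewrite (_ : th _ = th (fun k => (-1) ^+ k * icheb 2 k)); last first.
  by congr th; apply: funext => k; rewrite /icheb ic.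
rewrite -triple_product exprS; congr (_ * _).
rewrite expr2 /f1 (iprodM pgood_f1 pgood_f1).
apply: eq_iprod => m; rewrite mul2n -addnn qmD; ring.
Qed.

Definition th1 : fz := th (fun k => (-1) ^+ k * icheb 1 k).

(** The case [y = 1], by [(1 - t + t^2)(1 + t) = 1 + t^3]. *)
Lemma th1_f : th1 * f 2 * f 3 = f1 ^+ 2 * f 6.
Proof.
have e1 : th1 * fplus = f1 * dil 3 fplus.
  rewrite /th1 -triple_product -mulrA; congr (_ * _).
  rewrite /fplus (iprod_dil _ pgood_fplus) // (iprodM (pgood_quad 1) pgood_fplus).
  apply: eq_iprod => m; rewrite dilD dil1 // dil_qm //.
  have -> : (3 * m.+1 = m.+1 + (m.+1 + m.+1))%N by lia.
  by rewrite mul2n -addnn !qmD; ring.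
have e3 : dil 3 fplus * f 3 = f 6 by rewrite /f -dilM // fplusM dil_f.
rewrite -fplusM -e3; transitivity (th1 * fplus * f1 * f 3); first by ring.
by rewrite e1; ring.
Qed.

(** The case [y = 0], where the factors are [1 + q^(2m)]. *)
Lemma neg_psi : neg psi * f 2 = f1 * f 4.
Proof.
have ic k : icheb2 0 k.*2 = ((-1) ^+ k, - (-1) ^+ k).
  by elim: k => // k; rewrite doubleS /= => ->; rewrite exprS; congr (_, _); ring.
(* Both sides have period 4 in [k], with values 1, -1, -1, 1; hence the theta series is [psi] at
   [-q]. *)
have ic' k : (-1) ^+ k * icheb 0 k = (-1) ^+ tri k.
  have tri4 j : odd (tri j.*2) = odd j /\ odd (tri j.*2.+1) = ~~ odd j.
    have -> : tri j.*2 = (j * j.*2.+1)%N by have := tri2 j.*2; nia.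
    have -> : tri j.*2.+1 = (j.*2.+1 * j.+1)%N by have := tri2 j.*2.+1; nia.
    by rewrite !oddM /= odd_double andbT.
  have s2 m : (-1) ^+ m.*2 = 1 :> int by rewrite -mul2n exprM sqrrN !expr1n.
  rewrite -(odd_double_half k); case: (odd k); rewrite ?add0n ?add1n /icheb.
    rewrite /= ic exprS s2 -[RHS]signr_odd (tri4 _).2.
    by rewrite /= -[in LHS]signr_odd; case: (odd _) => /=; ring.
  by rewrite ic s2 -[RHS]signr_odd (tri4 _).1 /= signr_odd mul1r.
have -> : neg psi = f1 * dil 2 fplus.
  transitivity (th (fun k => (-1) ^+ k * icheb 0 k)).
    apply: fpsP => n; rewrite cf_scalE /= mulr_sumr; apply: eq_bigr => k /eqP e.
    by rewrite ic' mulr1 e.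
  rewrite -triple_product; congr (_ * _).
  rewrite /fplus (iprod_dil _ pgood_fplus) //.
  by apply: eq_iprod => m; rewrite dilD dil1 // dil_qm //; ring.
rewrite -mulrA; congr (_ * _).
by rewrite /f -dilM // fplusM dil_f.
Qed.

(** The case [y = -1], by [(1 - t)(1 + t + t^2) = 1 - t^3]. *)
Lemma f3_theta : f 3 = th (fun k => (-1) ^+ k * icheb (-1) k).
Proof.
rewrite -triple_product /f /f1 (iprod_dil _ pgood_f1) //.
rewrite (iprodM pgood_f1 (pgood_quad (-1))).
apply: eq_iprod => m; rewrite dilB dil1 // dil_qm //.
have -> : (3 * m.+1 = m.+1 + (m.+1 + m.+1))%N by lia.
by rewrite mul2n -addnn !qmD; ring.
Qed.

(** * Trisections *)

Lemma tri_inj : injective tri.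
Proof.
have lt i j : (i < j)%N -> (tri i < tri j)%N.
  elim: j => // j IH; rewrite ltnS leq_eqVlt => /predU1P[->|/IH h];
  rewrite triS; lia.
by move=> i j e; case: (ltngtP i j) => // /lt; rewrite e ltnn.
Qed.

Variant th_spec (u : nat -> int) (N : nat) : int -> Type :=
  | ThTri k of N = tri k : th_spec u N (u k)
  | ThNone of (forall k, tri k <> N) : th_spec u N 0.

Lemma thP u N : th_spec u N (cf (th u) N).
Proof.
rewrite /=; case: (boolP [exists k : 'I_N.+1, tri k == N]) => [/existsP|/existsPn] h.
  have [k /eqP kN] := sigW h; rewrite (big_pred1 k).
    by constructor.
  move=> j; apply/eqP/eqP => [e|->//].
  by apply: val_inj; apply: tri_inj; rewrite e.
rewrite big_pred0; last by move=> k; apply/negbTE.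
constructor => k kN; have kl : (k < N.+1)%N by rewrite ltnS -kN tri_ge.
by have := h (Ordinal kl); rewrite /= kN eqxx.
Qed.

Lemma th_tri u k : cf (th u) (tri k) = u k.
Proof. by case: thP => [j /tri_inj->|/(_ k)]. Qed.

Lemma mod3P n : exists j, n = (3 * j)%N \/ n = (3 * j).+1 \/ n = (3 * j).+2.
Proof. by exists (n %/ 3)%N; lia. Qed.

Lemma tri3_1 j : tri (3 * j).+1 = (9 * tri j + 1)%N.
Proof. by have := tri2 (3 * j).+1; have := tri2 j; nia. Qed.

Lemma tri3_0 j : exists i, tri (3 * j) = (3 * i)%N.
Proof.
elim: j => [|j [i e]]; first by exists 0%N.
exists (i + 3 * j + 2)%N; rewrite mulnS !triS e; lia.
Qed.

Lemma tri3_2 j : exists i, tri (3 * j).+2 = (3 * i)%N.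
Proof. by have [i e] := tri3_0 j; exists (i + 2 * j + 1)%N; rewrite !triS e; lia. Qed.

Lemma tri_mod3_1 k N : tri k = (3 * N + 1)%N -> exists2 j, k = (3 * j).+1 & N = (3 * tri j)%N.
Proof.
have [j [->|[->|->]]] := mod3P k.
- by have [i ->] := tri3_0 j; lia.
- by rewrite tri3_1 => e; exists j => //; lia.
- by have [i ->] := tri3_2 j; lia.
Qed.

Lemma sec32_th u : sec 3 2 (th u) = 0.
Proof.
apply: fpsP => n; rewrite cf_secE cf0; case: thP => // k e; exfalso.
have [j [ek|[ek|ek]]] := mod3P k; subst k; move: e.
- by have [i ->] := tri3_0 j; lia.
- by rewrite tri3_1; lia.
- by have [i ->] := tri3_2 j; lia.
Qed.

(** A triangular number is 1 modulo 3 only at an index [3j+1], where it equals [9 tri j + 1]. *)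
Lemma sec31_th u : sec 3 1 (th u) = dil 3 (th (fun k => u (3 * k).+1)).
Proof.
apply: fpsP => n; rewrite cf_secE; case: thP => [k e|h].
  have [j -> ->] := tri_mod3_1 (esym e).
  by rewrite cf_dil // th_tri.
rewrite cf_dilE; case: ifP => // /dvdnP[m e]; case: thP => // k ek.
by case: (h (3 * k).+1); rewrite tri3_1 e; move: ek; rewrite e mulnK //; lia.
Qed.

(** The indices [3j+1] do not reach this section, so quite different theta series can share it. This
    is what [th1_split] and [n0_mod8] exploit. *)
Lemma sec30_th u v : (forall j, u (3 * j)%N = v (3 * j)%N) ->
  (forall j, u (3 * j).+2 = v (3 * j).+2) -> sec 3 0 (th u) = sec 3 0 (th v).
Proof.
move=> h0 h2; apply: fpsP => n; rewrite !cf_secE.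
case: (thP u) => [k e|h]; last by case: thP => // k /esym /h.
rewrite e th_tri; have [j [ek|[ek|ek]]] := mod3P k; rewrite ek ?h0 ?h2 //.
by move: e; rewrite ek tri3_1; lia.
Qed.

Lemma thD u v : th (fun k => u k + v k) = th u + th v.
Proof. by apply: fpsP => n; rewrite cfD /= big_split. Qed.
Lemma thZ (c : int) u : th (fun k => c * u k) = c%:~R * th u.
Proof. by apply: fpsP => n; rewrite cf_intM /= mulr_sumr. Qed.

Definition g : fz := sec 3 0 psi.
Definition c0 : fz := sec 3 0 (f1 ^+ 3).
Definition n0 : fz := sec 3 0 (f1 ^+ 3 * PDtser).

Lemma psi_split : psi = dil 3 g + q * dil 9 psi.
Proof.
rewrite {1}[psi]sec_split3 /psi sec32_th sec31_th dil_dil // -/psi -/g.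
by rewrite [dil 3 0](_ : _ = 0) ?mulr0 ?addr0 //; apply: fpsP => n; rewrite cf_dilE; case: ifP.
Qed.

Lemma dil0 k : dil k (0 : fz) = 0.
Proof. by apply: fpsP => n; rewrite cf_dilE; case: ifP. Qed.

Lemma f1_cubed_split : f1 ^+ 3 = dil 3 c0 - 3 * q * f 9 ^+ 3.
Proof.
rewrite {1}[f1 ^+ 3]sec_split3 -/c0 {1 2}f1_cubed sec32_th sec31_th dil0 mulr0 addr0.
congr (_ + _); rewrite dil_dil //.
have -> : th (fun k => (-1) ^+ (3 * k).+1 * (2 * (3 * k).+1%:Z + 1)) =
          (-3)%:~R * f1 ^+ 3.
  rewrite f1_cubed -thZ; congr th; apply: funext => k.
  have -> : (-1) ^+ (3 * k).+1 = - (-1) ^+ k :> int.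
    by rewrite exprS exprM -[(-1) ^+ 3]/(-1) mulN1r.
  have -> : (3 * k).+1%:Z = 3 * k%:Z + 1 by lia.
  ring.
have -> : (-3)%:~R = - 3%:R :> fz by [].
by rewrite mulNr dilN dil_natM dilX // -[(3 * 3)%N]/9%N -/(f 9); ring.
Qed.

Lemma icheb1_3 k : icheb2 1 (3 * k) = ((-1) ^+ k, - (-1) ^+ k).
Proof.
elim: k => // k IH; have -> : (3 * k.+1 = (3 * k).+3)%N by lia.
by rewrite /= IH exprS; congr (_, _); ring.
Qed.

Lemma ichebN1_3 k : icheb2 (-1) (3 * k) = (1, -1).
Proof.
elim: k => // k IH; have -> : (3 * k.+1 = (3 * k).+3)%N by lia.
by rewrite /= IH.
Qed.

Lemma dcheb_3 k : dcheb2 (3 * k) =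
  (((-1) ^+ k, - (-1) ^+ k), (- (-1) ^+ k * (3 * k%:Z), - (-1) ^+ k * (3 * k%:Z))).
Proof.
elim: k => // k IH; have -> : (3 * k.+1 = (3 * k).+3)%N by lia.
rewrite /= IH exprS; have -> : k.+1%:Z = k%:Z + 1 by lia.
by congr (_, _, (_, _)); ring.
Qed.

Lemma sign3 k : (-1) ^+ (3 * k) = (-1) ^+ k :> int.
Proof. by rewrite exprM. Qed.

(** The coefficients of [th1] repeat 1, -2, 1, hence agree with those of [psi] off the indices
    [3j+1]. *)
Lemma th1_split : th1 = dil 3 g - 2 * q * dil 9 psi.
Proof.
rewrite {1}[th1]sec_split3 /th1 sec32_th sec31_th dil0 mulr0 addr0.
congr (_ + _).
  congr dil; apply: sec30_th => j.
    by rewrite sign3 /icheb icheb1_3 sqr_sign.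
  rewrite !exprS sign3 /icheb /= icheb1_3 /=.
  have := sqr_sign j; by set s := (-1) ^+ j => h; transitivity (s * s); [ring|].
have -> : th (fun k => (-1) ^+ (3 * k).+1 * icheb 1 (3 * k).+1) =
          (-2)%:~R * psi.
  rewrite -thZ; congr th; apply: funext => k.
  rewrite exprS sign3 /icheb /= icheb1_3 /=.
  have := sqr_sign k; by set s := (-1) ^+ k => h; transitivity (-2 * (s * s)); [ring|rewrite h].
have -> : (-2)%:~R = - 2%:R :> fz by [].
by rewrite mulNr !dilN !dil_natM dil_dil // -[(3 * 3)%N]/9%N; ring.
Qed.

(** By [dcheb_3] the coefficients at [3j], [3j+1], [3j+2] are [3j], [1], [-(3j+3)]; the middle ones
    rebuild [psi]. *)
Lemma PDtser_split : f1 ^+ 3 * PDtser = dil 3 n0 + q * dil 9 psi.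
Proof.
rewrite {1}[f1 ^+ 3 * _]sec_split3 -/n0 {1 2}PDtser_f1 sec32_th sec31_th.
rewrite dil0 mulr0 addr0; congr (_ + q * _); rewrite -(@dil_dil _ 3 3) //.
do 2!congr dil; congr th; apply: funext => k.
rewrite exprS sign3 /dcheb /= dcheb_3 /=.
have := sqr_sign k; by set s := (-1) ^+ k => h; transitivity (s * s); [ring|].
Qed.

(** Here [f1] enters as the section of [f 3]. The comparison is made term by term at [3j] and
    [3j+2]: for either parity of [j] the signs become explicit and the difference [d] is visibly a
    multiple of 8. *)
Lemma n0_mod8 : exists w, 2 * n0 = f1 + 2 * g - 3 * c0 + 8 * w.
Proof.
pose d k : int := 2 * - ((-1) ^+ k * dcheb k) -
  ((-1) ^+ k * icheb (-1) k + 2 - 3 * ((-1) ^+ k * (2 * k%:Z + 1))).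
pose w k := (d k %/ 8)%Z; exists (sec 3 0 (th w)).
have f1E : f1 = sec 3 0 (th (fun k => (-1) ^+ k * icheb (-1) k)).
  by rewrite -f3_theta sec_dil.
rewrite /n0 PDtser_f1 {}f1E /g /psi /c0 f1_cubed.
rewrite -!sec_natmul -!secD -!secB -!secD.
have E (c : nat) : c%:R = (c%:Z)%:~R :> fz by rewrite -pmulrn.
rewrite !E -!thZ -!thD.
have -> v u : th u - th v = th (fun k => u k - v k).
  by apply: fpsP => n; rewrite cfB /= sumrB.
rewrite -thD; apply: sec30_th => j.
  have h : (8 %| d (3 * j)%N)%Z.
    rewrite /d sign3 /icheb /dcheb ichebN1_3 dcheb_3 /=.
    have -> : (3 * j)%N%:Z = 3 * j%:Z by lia.
    rewrite -signr_odd; case: (boolP (odd j)) => oj /=; lia.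
  by rewrite /w [X in _ + X]mulrC divzK // /d; ring.
have h : (8 %| d (3 * j).+2)%Z.
  rewrite /d !exprS sign3 /icheb /dcheb /= ichebN1_3 dcheb_3 /=.
  have -> : (3 * j).+2%:Z = 3 * j%:Z + 2 by lia.
  rewrite -signr_odd; case: (boolP (odd j)) => oj /=; lia.
by rewrite /w [X in _ + X]mulrC divzK // /d; ring.
Qed.

(** * Lattice sums *)

Lemma count_bij (T1 T2 : eqType) (r1 : seq T1) (r2 : seq T2) (P1 : pred T1)
    (P2 : pred T2) (h : T1 -> T2) (h' : T2 -> T1) : uniq r1 -> uniq r2 ->
  (forall x, P1 x -> [/\ h x \in r2, P2 (h x) & h' (h x) = x]) ->
  (forall y, P2 y -> [/\ h' y \in r1, P1 (h' y) & h (h' y) = y]) ->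
  count P1 r1 = count P2 r2.
Proof.
move=> u1 u2 H1 H2; rewrite -!size_filter -(size_map h); apply: perm_size.
apply: uniq_perm; first 1 last.
- exact: filter_uniq.
- move=> y; rewrite mem_filter; apply/mapP/andP => [[x]|[Py yr]].
    by rewrite mem_filter => /andP[/H1[? ? _] _] ->.
  by have [? ? e] := H2 y Py; exists (h' y); rewrite ?mem_filter ?e //; apply/andP.
- rewrite map_inj_in_uniq ?filter_uniq // => x y; rewrite !mem_filter.
  by move=> /andP[/H1[_ _ ex] _] /andP[/H1[_ _ ey] _] e; rewrite -ex e ey.
Qed.

Lemma count_bijz (r1 r2 : seq (int * int)) (P1 P2 : pred (int * int))
    (h h' : int * int -> int * int) : uniq r1 -> uniq r2 ->
  (forall x y : int, P1 (x, y) ->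
     [/\ h (x, y) \in r2, P2 (h (x, y)) & h' (h (x, y)) = (x, y)]) ->
  (forall x y : int, P2 (x, y) ->
     [/\ h' (x, y) \in r1, P1 (h' (x, y)) & h (h' (x, y)) = (x, y)]) ->
  count P1 r1 = count P2 r2.
Proof.
by move=> u1 u2 H1 H2; apply: (count_bij u1 u2) => -[x y]; [apply: H1|apply: H2].
Qed.

Definition zr B : seq int := map Posz (iota 0 B) ++ map Negz (iota 0 B).

Lemma mem_zr B x : (x \in zr B) = (- B%:Z <= x) && (x < B%:Z).
Proof.
rewrite mem_cat; case: x => k.
  rewrite (mem_map (fun _ _ => _)) ?mem_iota /=; last by move=> ? ? [].
  have -> : (Posz k \in map Negz (iota 0 B)) = false by apply/mapP => -[].
  by rewrite orbF; apply/idP/andP => [|[]]; lia.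
rewrite (mem_map (f := Negz)) ?mem_iota /=; last by move=> ? ? [].
have -> : (Negz k \in map Posz (iota 0 B)) = false by apply/mapP => -[].
by apply/idP/andP => [|[]]; lia.
Qed.

Lemma zr_uniq B : uniq (zr B).
Proof.
rewrite cat_uniq !map_inj_uniq ?iota_uniq ?andbT /=; try by move=> ? ? [].
by apply/hasPn => x /mapP[k _ ->]; apply/mapP => -[].
Qed.

(** All integers [m] with [e m = N] lie in the box [zr N.+1], so a count over this box, or over a
    larger one, is a count over all integers. *)
Definition proper_exp (e : int -> nat) := forall m, m \in zr (e m).+1.

Definition zth (e : int -> nat) : fz :=
  Fps (fun N => (count (fun m => e m == N) (zr N.+1))%:R).

Lemma cf_zth e N : cf (zth e) N = (count (fun m => e m == N) (zr N.+1))%:R.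
Proof. by []. Qed.

Lemma zth_box e B N : proper_exp e -> (N < B)%N ->
  cf (zth e) N = (count (fun m => e m == N) (zr B))%:R.
Proof.
move=> pe NB; rewrite cf_zth; congr (_%:R).
apply: (@count_bij _ _ _ _ _ _ id id) => [||x|x].
- exact: zr_uniq.
- exact: zr_uniq.
- move=> /eqP ex; split=> //; last exact/eqP.
  by have := pe x; rewrite ex !mem_zr; lia.
- by move=> /eqP ex; split=> //; [rewrite -ex|apply/eqP].
Qed.

Definition zr2 B := [seq (x, y) | x <- zr B, y <- zr B].

Lemma mem_zr2 B p : (p \in zr2 B) = (p.1 \in zr B) && (p.2 \in zr B).
Proof.
apply/allpairsP/andP => [[[x y] /= [hx hy ->]] //|[hx hy]].
by exists p; split => //; case: p {hx hy}.
Qed.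

Lemma zr2_uniq B : uniq (zr2 B).
Proof. by apply: allpairs_uniq; rewrite ?zr_uniq // => -[? ?] [? ?]. Qed.

Lemma zthM e e' B N : proper_exp e -> proper_exp e' -> (N < B)%N ->
  cf (zth e * zth e') N =
  (count (fun p => e p.1 + e' p.2 == N)%N (zr2 B))%:R.
Proof.
move=> pe pe' NB; rewrite cfM.
rewrite (eq_bigr (fun i : 'I_N.+1 => (\sum_(x <- zr B) \sum_(y <- zr B)
    ((e x == i) * (e' y == N - i))%N)%:R)); last first.
  move=> i _; rewrite !(@zth_box _ B) //; [|lia|by have := ltn_ord i; lia].
  rewrite -natrM; congr (_%:R); rewrite -!sum1_count !(big_mkcond (fun m => _ == _)) /=.
  rewrite big_distrl /=; apply: eq_bigr => x _; rewrite big_distrr /=.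
  by apply: eq_bigr => y _; do 2!case: eqP.
rewrite -natr_sum; congr (_%:R); rewrite -sum1_count [RHS]big_mkcond /=.
rewrite exchange_big /= [RHS]big_allpairs; apply: eq_bigr => x _.
rewrite exchange_big /=; apply: eq_bigr => y _.
case: eqP => [h|h].
  have ltx : (e x < N.+1)%N by lia.
  rewrite (bigD1 (Ordinal ltx)) //= eqxx mul1n big1 ?addn0.
    by apply/eqP; rewrite eqb1; apply/eqP; lia.
  by move=> i; rewrite -val_eqE eq_sym /= => /negbTE->.
rewrite big1 // => i _; have := ltn_ord i; case: eqP => // e1.
by case: eqP => // hy; lia.
Qed.

Definition triz (m : int) : nat := match m with Posz k => tri k | Negz k => tri k end.
Definition sqz (m : int) : nat := (`|m| * `|m|)%N.

Lemma triz2 m : 2 * (triz m)%:Z = m * (m + 1).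
Proof. by case: m => k; rewrite /triz; have := tri2 k; nia. Qed.
Lemma sqzE m : (sqz m)%:Z = m * m.
Proof. by rewrite /sqz; nia. Qed.

Lemma proper_triz : proper_exp triz.
Proof. by move=> m; rewrite mem_zr; case: m => k /=; have := tri_ge k; lia. Qed.
Lemma proper_sqz : proper_exp sqz.
Proof. by move=> m; rewrite mem_zr; have := sqzE m; nia. Qed.
Lemma proper_mul k e : (0 < k)%N -> proper_exp e -> proper_exp (fun m => (k * e m)%N).
Proof.
move=> k0 pe m; have := pe m; have : (e m <= k * e m)%N by rewrite leq_pmull.
by rewrite !mem_zr; lia.
Qed.

Lemma zth_mul k e : (0 < k)%N -> proper_exp e ->
  zth (fun m => (k * e m)%N) = dil k (zth e).
Proof.
move=> k0 pe; apply: fpsP => N; rewrite cf_dilE; case: ifP => [/dvdnP[j ->]|nd].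
  rewrite mulnK // (zth_box pe (B := (j * k).+1)) ?cf_zth; last first.
    by rewrite ltnS leq_pmulr.
  by congr (_%:R); apply: eq_count => m; rewrite mulnC eqn_pmul2r.
rewrite cf_zth (eq_count (a2 := pred0)) ?count_pred0 // => m /=.
by apply/eqP => e1; rewrite -e1 dvdn_mulr in nd.
Qed.

Definition phi : fz := zth sqz.

(** The integers [m] and [-1 - m] give the same triangular number. *)
Lemma zth_triz : zth triz = 2 * psi.
Proof.
apply: fpsP => N; rewrite cf_natM cf_zth count_cat !count_map addnn -mul2n natrM.
congr (_ * _); rewrite [RHS](_ : _ = \sum_(k < N.+1 | tri k == N) 1) //.
rewrite -(big_mkord (fun k => tri k == N) (fun _ => 1)) -sum1_count.
by rewrite natr_sum /index_iota subn0.
Qed.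

Lemma cf2_inj (a b : fz) : 2 * a = 2 * b -> a = b.
Proof.
move=> e; apply: fpsP => n; have := congr1 (fun x => cf x n) e.
by rewrite !cf_natM => /(mulfI (isT : 2%:R != 0 :> int)).
Qed.

Lemma zr_le e m B : proper_exp e -> (e m < B)%N -> m \in zr B.
Proof. by move=> pe; have := pe m; rewrite !mem_zr; lia. Qed.

Lemma count_predID (T : Type) (P Q : pred T) r :
  count P r = (count (predI P Q) r + count (predI P (predC Q)) r)%N.
Proof. by elim: r => //= p r ->; case: (P p); case: (Q p) => /=; lia. Qed.

(** After multiplication by 4 both sides count pairs of integers. For [m] and [n] of equal parity,
    [m = s + t] and [n = s - t] turn [triz m + triz n] into [t^2 + 2 triz s]. Pairs of opposite
    parity are brought to this case by [n -> -1 - n]. *)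
Lemma phi_psi2 : psi ^+ 2 = phi * dil 2 psi.
Proof.
do 2!apply: cf2_inj.
have -> : 2 * (2 * psi ^+ 2) = zth triz * zth triz by rewrite zth_triz; ring.
have -> : 2 * (2 * (phi * dil 2 psi)) =
    2 * (zth sqz * zth (fun m => (2 * triz m)%N)).
  rewrite zth_mul //; last exact: proper_triz.
  by rewrite zth_triz dil_natM -/phi; ring.
have p2 := proper_mul (isT : (0 < 2)%N) proper_triz.
apply: fpsP => N; rewrite cf_natM; pose B := (2 * N + 4)%N.
rewrite !(@zthM _ _ B) //; try exact: proper_triz; try exact: proper_sqz; try lia.
rewrite -natrM; congr (_%:R).
have bt x : (triz x < B)%N -> x \in zr B := zr_le proper_triz.
have bs x : (sqz x < B)%N -> x \in zr B := zr_le proper_sqz.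
rewrite (count_predID _ (fun p => (2 %| p.1 - p.2)%Z)) mul2n -addnn.
congr (_ + _)%N.
  apply: (@count_bij _ _ _ _ _ _
    (fun p => ((p.1 - p.2) %/ 2, (p.1 + p.2) %/ 2)%Z)
    (fun p => (p.2 + p.1, p.2 - p.1))) => [||[m n]|[t s]]; rewrite ?zr2_uniq //=.
  - case/andP => /eqP h d; have := triz2 m; have := triz2 n.
    set s := ((m + n) %/ 2)%Z; set t := ((m - n) %/ 2)%Z.
    have [em en] : m = s + t /\ n = s - t by lia.
    clearbody s t; subst m n.
    have := triz2 s; have := sqzE t => e1 e2 e3 e4.
    have e : (sqz t + 2 * triz s)%N = N.
      by nia.
    rewrite mem_zr2 bs ?bt /= ?e; try by rewrite /B; lia.
    by [].
  - move/eqP => h; have := triz2 s; have := sqzE t => e1 e2.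
    have e : (triz (s + t) + triz (s - t))%N = N.
      by have := triz2 (s + t); have := triz2 (s - t); nia.
    rewrite mem_zr2 !bt /= ?e ?eqxx; try by rewrite /B; lia.
    split=> //; first by lia.
    by congr (_, _); lia.
apply: (@count_bij _ _ _ _ _ _
    (fun p => ((p.1 + p.2 + 1) %/ 2, (p.1 - p.2 - 1) %/ 2)%Z)
    (fun p => (p.2 + p.1, p.1 - p.2 - 1))) => [||[m n]|[t s]]; rewrite ?zr2_uniq //=.
  - case/andP => /eqP h d; have := triz2 m; have := triz2 n.
    set s := ((m - n - 1) %/ 2)%Z; set t := ((m + n + 1) %/ 2)%Z.
    have [em en] : m = s + t /\ n = t - s - 1 by lia.
    clearbody s t; subst m n.
    have := triz2 s; have := sqzE t => e1 e2 e3 e4.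
    have e : (sqz t + 2 * triz s)%N = N.
      by nia.
    rewrite mem_zr2 bs ?bt /= ?e; try by rewrite /B; lia.
    by [].
  - move/eqP => h; have := triz2 s; have := sqzE t => e1 e2.
    have e : (triz (s + t) + triz (t - s - 1))%N = N.
      by have := triz2 (s + t); have := triz2 (t - s - 1); nia.
    rewrite mem_zr2 !bt /= ?e ?eqxx; try by rewrite /B; lia.
    split=> //; first by lia.
    by congr (_, _); lia.
Qed.

Lemma q_zthM e e' B N : proper_exp e -> proper_exp e' -> (N < B)%N ->
  cf (q * (zth e * zth e')) N =
  (count (fun p => (e p.1 + e' p.2).+1 == N)%N (zr2 B))%:R.
Proof.
move=> pe pe' NB; rewrite cf_qmM; case: N NB => [|N] NB.
  by rewrite (eq_count (a2 := pred0)) ?count_pred0.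
by rewrite subn1 (zthM pe pe' (B := B)) //; lia.
Qed.

(** Again 4 times both sides are counted. With [m = i + 3j] and [n = i - j], [triz m + 3 triz n]
    becomes [4 triz i + 6 j^2]; this covers [m - n] divisible by 4. A shifted substitution covers
    [m - n = 2] modulo 4. The two classes with [m - n] odd are mirror images under [n -> -1 - n]. *)
Lemma psi_psi3 :
  psi * dil 3 psi = dil 4 psi * dil 6 phi + q * dil 2 phi * dil 12 psi.
Proof.
have pt k : (0 < k)%N -> _ := fun k0 => proper_mul k0 proper_triz.
have ps k : (0 < k)%N -> _ := fun k0 => proper_mul k0 proper_sqz.
have zt k : (0 < k)%N -> zth (fun m => (k * triz m)%N) = 2 * dil k psi.
  by move=> k0; rewrite zth_mul ?zth_triz ?dil_natM //; exact: proper_triz.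
have zs k : (0 < k)%N -> zth (fun m => (k * sqz m)%N) = dil k phi.
  by move=> k0; rewrite zth_mul //; exact: proper_sqz.
do 2!apply: cf2_inj.
transitivity (zth triz * zth (fun m => (3 * triz m)%N)).
  by rewrite zth_triz zt //; ring.
transitivity (
  2 * (zth (fun m => (4 * triz m)%N) * zth (fun m => (6 * sqz m)%N)) +
  2 * (q * (zth (fun m => (2 * sqz m)%N) * zth (fun m => (12 * triz m)%N))));
  last by rewrite !zt ?zs //; ring.
apply: fpsP => N; rewrite cfD !cf_natM; pose B := (2 * N + 4)%N.
rewrite !(@zthM _ _ B) ?(@q_zthM _ _ B) //; try exact: pt; try exact: ps;
  try exact: proper_triz; try (rewrite /B; lia).
rewrite -!natrM -natrD; congr (_%:R).
have bt x : (triz x < B)%N -> x \in zr B := zr_le proper_triz.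
have bs x : (sqz x < B)%N -> x \in zr B := zr_le proper_sqz.
pose P := (fun p : int * int => triz p.1 + 3 * triz p.2 == N)%N.
pose Q2 := fun p : int * int => (2 %| p.1 - p.2)%Z.
rewrite (count_predID P Q2).
rewrite (count_predID (predI P Q2) (fun p => (4 %| p.1 - p.2)%Z)).
rewrite (count_predID (predI P (predC Q2)) (fun p => (4 %| p.1 + p.2 + 1)%Z)).
(* Each product on the right occurs twice, once for a class of even [m - n] and once for its mirror
   image; the regrouping puts the four summands in the order of the four classes. *)
rewrite !mul2n -!addnn [RHS]addnACA /P /Q2 {P Q2}; congr (_ + _ + (_ + _))%N.
- apply: (@count_bijz _ _ _ _
    (fun p : int * int => (p.2 + ((p.1 - p.2) %/ 4)%Z, ((p.1 - p.2) %/ 4)%Z))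
    (fun p : int * int => (p.1 + 3 * p.2, p.1 - p.2))) => [||m n|i j]; rewrite ?zr2_uniq //=.
  + case/andP => /andP[/eqP h _] d; have := triz2 m; have := triz2 n.
    set j := ((m - n) %/ 4)%Z.
    have em : m = n + 4 * j by lia.
    clearbody j; subst m; move=> e3 e4.
    have := triz2 (n + j); have := sqzE j => e1 e2.
    have e : (4 * triz (n + j) + 6 * sqz j)%N = N by nia.
    rewrite mem_zr2 bt ?bs /= ?e; try by rewrite /B; lia.
    by split=> //; congr (_, _); lia.
  + move/eqP => h; have := triz2 i; have := sqzE j => e1 e2.
    have e : (triz (i + 3 * j) + 3 * triz (i - j))%N = N.
      by have := triz2 (i + 3 * j); have := triz2 (i - j); nia.
    rewrite mem_zr2 !bt /= ?e ?eqxx; try by rewrite /B; lia.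
    split=> //; first by lia.
    by congr (_, _); lia.
- apply: (@count_bijz _ _ _ _
    (fun p : int * int => (p.2 + ((p.1 - p.2 - 2) %/ 4)%Z + 1, ((p.1 - p.2 - 2) %/ 4)%Z))
    (fun p : int * int => (p.1 + 3 * p.2 + 1, p.1 - p.2 - 1))) => [||m n|j i];
    rewrite ?zr2_uniq //=.
  + case/andP => /andP[/eqP h d2] d; have := triz2 m; have := triz2 n.
    set i := ((m - n - 2) %/ 4)%Z.
    have em : m = n + 4 * i + 2 by lia.
    clearbody i; subst m; move=> e3 e4.
    have := triz2 i; have := sqzE (n + i + 1) => e1 e2.
    have e : (2 * sqz (n + i + 1)%R + 12 * triz i).+1%N = N by nia.
    rewrite mem_zr2 bs ?bt /= ?e; try by rewrite /B; lia.
    by split=> //; congr (_, _); lia.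
  + move/eqP => h; have := triz2 i; have := sqzE j => e1 e2.
    have e : (triz (j + 3 * i + 1) + 3 * triz (j - i - 1))%N = N.
      by have := triz2 (j + 3 * i + 1); have := triz2 (j - i - 1); nia.
    rewrite mem_zr2 !bt /= ?e ?eqxx; try by rewrite /B; lia.
    split=> //; first by lia.
    by congr (_, _); lia.
- apply: (@count_bijz _ _ _ _
    (fun p : int * int => (((p.1 + p.2 + 1) %/ 4)%Z - 1 - p.2, ((p.1 + p.2 + 1) %/ 4)%Z))
    (fun p : int * int => (p.1 + 3 * p.2, p.2 - p.1 - 1))) => [||m n|i j];
    rewrite ?zr2_uniq //=.
  + case/andP => /andP[/eqP h _] d; have := triz2 m; have := triz2 n.
    set j := ((m + n + 1) %/ 4)%Z.
    have em : m = 4 * j - n - 1 by lia.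
    clearbody j; subst m; move=> e3 e4.
    have := triz2 (j - 1 - n); have := sqzE j => e1 e2.
    have e : (4 * triz (j - 1 - n)%R + 6 * sqz j)%N = N by nia.
    rewrite mem_zr2 bt ?bs /= ?e; try by rewrite /B; lia.
    by split=> //; congr (_, _); lia.
  + move/eqP => h; have := triz2 i; have := sqzE j => e1 e2.
    have e : (triz (i + 3 * j) + 3 * triz (j - i - 1))%N = N.
      by have := triz2 (i + 3 * j); have := triz2 (j - i - 1); nia.
    rewrite mem_zr2 !bt /= ?e ?eqxx; try by rewrite /B; lia.
    split=> //; first by lia.
    by congr (_, _); lia.
apply: (@count_bijz _ _ _ _
    (fun p : int * int => (((p.1 + p.2 - 1) %/ 4)%Z - p.2, ((p.1 + p.2 - 1) %/ 4)%Z))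
    (fun p : int * int => (p.1 + 3 * p.2 + 1, p.2 - p.1))) => [||m n|j i];
    rewrite ?zr2_uniq //=.
  + case/andP => /andP[/eqP h d2] d; have := triz2 m; have := triz2 n.
    set i := ((m + n - 1) %/ 4)%Z.
    have em : m = 4 * i + 1 - n by lia.
    clearbody i; subst m; move=> e3 e4.
    have := triz2 i; have := sqzE (i - n) => e1 e2.
    have e : (2 * sqz (i - n)%R + 12 * triz i).+1%N = N by nia.
    rewrite mem_zr2 bs ?bt /= ?e; try by rewrite /B; lia.
    by split=> //; congr (_, _); lia.
  + move/eqP => h; have := triz2 i; have := sqzE j => e1 e2.
    have e : (triz (j + 3 * i + 1) + 3 * triz (i - j))%N = N.
      by have := triz2 (j + 3 * i + 1); have := triz2 (i - j); nia.
    rewrite mem_zr2 !bt /= ?e ?eqxx; try by rewrite /B; lia.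
    split=> //; first by lia.
    by congr (_, _); lia.
Qed.

(** The squares of even and of odd integers: [(2j+1)^2 = 8 triz j + 1]. *)
Lemma phi_split : phi = dil 4 phi + 2 * q * dil 8 psi.
Proof.
have -> : dil 4 phi = zth (fun m => (4 * sqz m)%N).
  by rewrite zth_mul //; exact: proper_sqz.
have -> : 2 * q * dil 8 psi = q * zth (fun m => (8 * triz m)%N).
  rewrite zth_mul //; last exact: proper_triz.
  by rewrite zth_triz dil_natM; ring.
apply: fpsP => N; rewrite cfD cf_qmM; pose B := N.+1.
have p4 := proper_mul (isT : (0 < 4)%N) proper_sqz.
have p8 := proper_mul (isT : (0 < 8)%N) proper_triz.
have -> : (if (1 <= N)%N then cf (zth (fun m => (8 * triz m)%N)) (N - 1) else 0) =
  (count (fun m => (8 * triz m).+1 == N) (zr B))%:R.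
  rewrite /B; case: (N) => [|M].
    by rewrite (eq_count (a2 := pred0)) ?count_pred0.
  by rewrite subn1 (zth_box p8 (B := M.+2)).
rewrite (zth_box p4 (B := B)) // (zth_box proper_sqz (B := B)) // -natrD.
congr (_%:R); rewrite (count_predID _ (fun m => (2 %| m)%Z)); congr (_ + _)%N.
  apply: (@count_bij _ _ _ _ _ _ (fun m : int => m %/ 2)%Z (fun j : int => 2 * j)) => [||m|j];
    rewrite ?zr_uniq //=.
    case/andP => /eqP h d; have := sqzE m; set j := (m %/ 2)%Z.
    have em : m = 2 * j by lia.
    clearbody j; subst m => e1; have := sqzE j => e2.
    have e : (4 * sqz j)%N = N by nia.
    by rewrite e eqxx; split=> //; apply: (zr_le p4); rewrite e.
  move/eqP => h; have := sqzE j; have := sqzE (2 * j) => e1 e2.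
  have e : sqz (2 * j) = N by nia.
  rewrite e eqxx; split; [apply: (zr_le proper_sqz); rewrite e // | lia | lia].
apply: (@count_bij _ _ _ _ _ _ (fun m : int => m %/ 2)%Z (fun j : int => 2 * j + 1)) => [||m|j];
  rewrite ?zr_uniq //=.
  case/andP => /eqP h d; have := sqzE m; set j := (m %/ 2)%Z.
  have em : m = 2 * j + 1 by lia.
  clearbody j; subst m => e1; have := triz2 j => e2.
  have e : (8 * triz j).+1%N = N by nia.
  by rewrite e eqxx; split=> //; apply: (zr_le p8); rewrite /B; lia.
move/eqP => h; have := triz2 j; have := sqzE (2 * j + 1) => e1 e2.
have e : sqz (2 * j + 1) = N by nia.
rewrite e eqxx; split; [apply: (zr_le proper_sqz); rewrite e // | lia | lia].
Qed.

(** * Relations over the integers *)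

Lemma cf_psi : cf psi 0 = 1.
Proof. exact: (th_tri _ 0). Qed.

Definition ph : fz := neg phi.

Lemma psi_f k : (0 < k)%N -> dil k psi * f k = f (2 * k) ^+ 2.
Proof. by move=> k0; rewrite -dilM // psi_f1 dilX // dil_f // mulnC. Qed.

(** At [-q], [phi_psi2] expresses the square of [neg psi], and [neg_psi] gives the same square as a
    product. *)
Lemma ph_f2 : ph * f 2 = f1 ^+ 2.
Proof.
have c4 : cf (f 4 ^+ 2) 0 = 1 by rewrite cf_expr0 ?cf_f.
apply: (fps_mulI c4).
have h := congr1 (@neg _) phi_psi2.
rewrite negM (neg_dil2 _ (isT : ~~ odd 2)) expr2 negM -/ph in h.
have e2 := @psi_f 2 isT; rewrite -[(2 * 2)%N]/4%N in e2.
transitivity ((neg psi * f 2) ^+ 2); last by rewrite neg_psi; ring.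
rewrite -e2 [RHS](_ : _ = (neg psi * neg psi) * f 2 ^+ 2); last by ring.
by rewrite h; ring.
Qed.

Lemma ph_f k : (0 < k)%N -> dil k ph * f (2 * k) = f k ^+ 2.
Proof. by move=> k0; rewrite mulnC -dil_f // -dilM // ph_f2 dilX. Qed.

Lemma ph_psi : ph ^+ 2 * psi = f1 ^+ 3.
Proof.
have c : cf (f1 * f 2 ^+ 2) 0 = 1 by rewrite cfM0 cf_f1 cf_expr0 ?cf_f ?mulr1.
apply: (fps_mulI c).
transitivity ((ph * f 2) ^+ 2 * (psi * f1)); first by ring.
by rewrite ph_f2 psi_f1; ring.
Qed.

Lemma th1_f3 : th1 * f 3 = ph * f 6.
Proof.
have c : cf (f 2) 0 = 1 by rewrite cf_f.
apply: (fps_mulI c); transitivity (th1 * f 2 * f 3); first by ring.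
by rewrite th1_f -ph_f2; ring.
Qed.

Local Notation s := (dil 3 psi).
Local Notation p3 := (dil 3 ph).

(** With [a = g(q^3)] and [b = q psi(q^9)] the product [th1^2 psi] is [(a - 2b)^2 (a + b) = a^3 - 3
    a^2 b + 4 b^3]. As [(th1 f_3)^2 psi = f_1^3 f_6^2], comparison with [f1_cubed_split] in the
    residues 0 and 1 gives both equations. *)
Lemma trisect_f1_cubed :
  f1 ^+ 2 * (g ^+ 3 + 4 * q * s ^+ 3) = f 2 ^+ 2 * c0 /\
  f1 ^+ 2 * (3 * (g ^+ 2 * s)) = f 2 ^+ 2 * (3 * f 3 ^+ 3).
Proof.
have e : dil 3 (f1 ^+ 2 * (g ^+ 3 + 4 * q * s ^+ 3))
    - q * dil 3 (f1 ^+ 2 * (3 * (g ^+ 2 * s))) =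
    dil 3 (f 2 ^+ 2 * c0) - q * dil 3 (f 2 ^+ 2 * (3 * f 3 ^+ 3)).
  have h : (th1 * f 3) ^+ 2 * psi = f1 ^+ 3 * f 6 ^+ 2.
    by rewrite th1_f3 -ph_psi; ring.
  rewrite psi_split f1_cubed_split th1_split in h; move: h.
  rewrite !(dil_nat, dilM, dilD, dilX, dil_natM, dil_dil, dil_f, dil_qm) //.
  rewrite -[(3 * 3)%N]/9%N -[(3 * 2)%N]/6%N -/(f 3) -[(3 * 1)%N]/3%N (qmE _ 3).
  move=> h; apply: (etrans (etrans _ h)); ring.
split.
  have := congr1 (sec 3 0) e.
  by rewrite !secB !sec0_qM !sec_dil //= !mulr0 !subr0.
have := congr1 (sec 3 1) e.
by rewrite !secB !sec_qM !sec_dil //= !sub0r => /oppr_inj.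
Qed.

Lemma cf_mulI (c a b : fz) : cf c 0 != 0 -> c * a = c * b -> a = b.
Proof.
move=> c0 /eqP; rewrite -subr_eq0 -mulrBr => /eqP h; apply/eqP; rewrite -subr_eq0.
apply/eqP; apply: fpsP => n; elim/ltn_ind: n => n IH.
have := congr1 (fun x => cf x n) h; rewrite cfM big_ord_recl big1 => [|i _].
  by rewrite addr0 subn0 cf0 => /eqP; rewrite mulf_eq0 (negbTE c0) => /eqP.
by rewrite IH ?cf0 ?mulr0 // lift0; have := ltn_ord i; lia.
Qed.

(** The second equation of [trisect_f1_cubed] yields the equality of squares. The sum of the two
    sides has constant coefficient 2 and can be cancelled, which fixes the sign. *)
Lemma g_f : f1 * g = f 2 * p3.
Proof.
have e1 : (f1 * g) ^+ 2 = (f 2 * p3) ^+ 2.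
  have cs : cf (s) 0 = 1 by rewrite cf_dil_gt0 ?cf_psi.
  apply: (fps_mulI cs); have c3 : cf (3 : fz) 0 != 0 by rewrite cf_nat.
  apply: (cf_mulI c3).
  transitivity (f1 ^+ 2 * (3 * (g ^+ 2 * s))); first by ring.
  rewrite trisect_f1_cubed.2.
  have -> : f 3 ^+ 3 = p3 ^+ 2 * s by rewrite /f -dilX // -ph_psi dilM ?dilX.
  by ring.
have cc : cf (f1 * g + f 2 * p3) 0 != 0.
  by rewrite cfD !cfM0 cf_f1 cf_f // cf_dil_gt0 // /g cf_secE cf_psi.
apply/eqP; rewrite -subr_eq0; apply/eqP; apply: (cf_mulI cc); rewrite mulr0.
have -> : (f1 * g + f 2 * p3) * (f1 * g - f 2 * p3) =
  (f1 * g) ^+ 2 - (f 2 * p3) ^+ 2 by ring.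
by rewrite e1 subrr.
Qed.

Local Notation i2 := (fps_inv (f 2)).

Lemma c0E : c0 = p3 ^+ 2 * g + 4 * (q * f1 ^+ 2 * i2 ^+ 2 * s ^+ 3).
Proof.
have c : cf (f 2) 0 = 1 by rewrite cf_f.
have c2 : cf (f 2 ^+ 2) 0 = 1 by rewrite cf_expr0.
have h := fps_invP c.
apply: (fps_mulI c2); rewrite -trisect_f1_cubed.1.
transitivity ((f 2 * p3) ^+ 2 * g + 4 * (q * f1 ^+ 2 * (f 2 * i2) ^+ 2 * s ^+ 3));
  last by ring.
by rewrite -g_f h; ring.
Qed.

(** With [C = c0(q^3)] and [F = f_9^3], the divisor [C - 3 q F] is multiplied by
    [C^2 + 3 q C F + 9 q^2 F^2], which makes it [C^3 - 27 q^3 F^3], a series in [q^3] that leaves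
    the section. *)
Lemma PDt3_main : sec 3 0 PDtser * (c0 ^+ 3 - 27 * q * f 3 ^+ 9) =
  n0 * c0 ^+ 2 + 9 * q * s * f 3 ^+ 6.
Proof.
have h := PDtser_split; rewrite f1_cubed_split in h.
have e : dil 3 (c0 ^+ 3 - 27 * q * f 3 ^+ 9) * PDtser =
   dil 3 (n0 * c0 ^+ 2 + 9 * q * s * f 3 ^+ 6)
   + q * dil 3 (3 * (n0 * c0 * f 3 ^+ 3) + s * c0 ^+ 2)
   + q * (q * dil 3 (9 * (n0 * f 3 ^+ 6) + 3 * (s * c0 * f 3 ^+ 3))).
  rewrite !(dil_nat, dilB, dilM, dilD, dilX, dil_natM, dil_dil, dil_f, dil_qm) //.
  rewrite -[(3 * 3)%N]/9%N -[(3 * 1)%N]/3%N (qmE _ 3).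
  set C := dil 3 c0 in h *; set N := dil 3 n0 in h *.
  transitivity ((C - 3 * q * f 9 ^+ 3) * PDtser *
     (C ^+ 2 + 3 * q * C * f 9 ^+ 3 + 9 * q ^+ 2 * f 9 ^+ 6)); first by ring.
  by rewrite h; ring.
have := congr1 (sec 3 0) e.
rewrite sec_dilM // !secD !sec0_qM !sec_qM !sec_dil //= !mulr0 !addr0 => <-.
by rewrite mulrC.
Qed.

(** * Reduction modulo 2 *)

Lemma poly_F2_sqr (p : {poly 'F_2}) : p ^+ 2 = p \Po 'X^2.
Proof.
elim/poly_ind: p => [|p c IH]; first by rewrite comp_poly0 expr0n.
rewrite comp_poly_MXaddC -IH.
have -> : (p * 'X + c%:P) ^+ 2 = p ^+ 2 * 'X^2 + (c ^+ 2)%:P + 2%:R * (p * 'X * c%:P).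
  by rewrite polyC_exp; ring.
have -> : 2%:R = 0 :> {poly 'F_2} 
  by rewrite -polyC_natr (_ : 2%:R = 0 :> 'F_2) ?polyC0 //; apply: val_inj.
rewrite mul0r addr0; congr (_ + _%:P).
by case: c => -[|[|]] // ?; apply: val_inj.
Qed.

Lemma frob2 (a : fps 'F_2) : a ^+ 2 = dil 2 a.
Proof.
apply: fpsP => n; rewrite expr2 cf_dilE [LHS]cf_fps_mul -expr2.
rewrite poly_F2_sqr coef_comp_poly_Xn //; case: ifP => // d2.
by rewrite coef_trunc // leq_div.
Qed.

Lemma two_F2 : 2%:R = 0 :> fps 'F_2.
Proof. by apply: fpsP => n; rewrite cf_nat cf0; case: ifP => // _; apply: val_inj. Qed.

Definition r2 : fz -> fps 'F_2 := mapf [the {rmorphism int -> 'F_2} of intmul 1].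
HB.instance Definition _ := GRing.RMorphism.on r2.

Lemma r2_dil2 a : r2 (dil 2 a) = r2 a ^+ 2.
Proof. by rewrite frob2 /r2 mapf_dil. Qed.

Lemma r2_lift a b : r2 a = r2 b -> exists w, a = b + 2 * w.
Proof.
move=> h; exists (Fps (fun n => ((cf a n - cf b n) %/ 2)%Z)); apply: fpsP => n.
rewrite cfD cf_natM /=; have := congr1 (fun x => cf x n) h; rewrite /= => e.
have d : (2 %| cf a n - cf b n)%Z.
  have -> : (2 %| cf a n - cf b n)%Z = ((cf a n - cf b n)%:~R == 0 :> 'F_2).
    by rewrite (dvdz_pcharf (pchar_Fp (isT : prime 2))).
  by rewrite rmorphB /= e subrr.
by rewrite mulrC divzK // addrC subrK.
Qed.

Lemma neg_F2 (a : fps 'F_2) : neg a = a.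
Proof.
apply: fpsP => n; rewrite cf_scalE (_ : -1 = 1 :> 'F_2) ?expr1n ?mul1r //.
exact: val_inj.
Qed.

Lemma neg_involutive : involutive (@neg int).
Proof.
move=> a; apply: fpsP => n; rewrite !cf_scalE mulrA -exprMn mulN1r opprK.
by rewrite expr1n mul1r.
Qed.

Lemma neg_dil_odd k (a : fz) : odd k -> neg (dil k a) = dil k (neg a).
Proof.
move=> ok; apply: fpsP => n; rewrite cf_scalE !cf_dilE; case: ifP => [/dvdnP[j ->]|].
  have k0 : (0 < k)%N by case: k ok.
  rewrite mulnK // cf_scalE -[in LHS]signr_odd oddM ok andbT signr_odd //.
by rewrite mulr0.
Qed.

Lemma r2_const a : cf a 0 = 1 -> cf (r2 a) 0 = 1.
Proof. by move=> e; rewrite cf_mapf e rmorph1. Qed.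

Lemma r2_ph : r2 ph = 1.
Proof.
have c : cf (r2 f1 ^+ 2) 0 = 1 by rewrite cf_expr0 ?r2_const ?cf_f1.
apply: (fps_mulI c); rewrite mulr1 -{1}r2_dil2 -/(f 2) -rmorphXn -ph_f2.
by rewrite rmorphM mulrC.
Qed.

(** The series is the sum of the [q^(n^2)] over [n >= 1]. A sigma type, obtained by choice, allows
    [aser] to be defined by projection. *)
Lemma phi_odd : {A : fz | phi = 1 + 2 * A}.
Proof.
apply: cid.
have [w e] : exists w, ph = 1 + 2 * w by apply: r2_lift; rewrite r2_ph rmorph1.
exists (neg w); rewrite -[phi]neg_involutive -/ph e.
by rewrite negD neg1 neg_natM.
Qed.

Definition aser : fz := projT1 phi_odd.
Local Notation A := aser.
Local Notation A3 := (dil 3 aser).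

Lemma phiE : phi = 1 + 2 * A.
Proof. exact: projT2 phi_odd. Qed.

Lemma phE : ph = 1 + 2 * neg A.
Proof. by rewrite /ph phiE negD neg1 neg_natM. Qed.

Lemma p3E : p3 = 1 + 2 * neg A3.
Proof. by rewrite phE dilD dil1 // dil_natM neg_dil_odd. Qed.

Lemma cf_A : cf A 0 = 0.
Proof.
have h : cf phi 0 = 1 by rewrite cf_zth.
move: h; rewrite phiE cfD cf_natM cf1 => /(canRL (addKr _)).
by rewrite addNr => /eqP; rewrite mulf_eq0 => /eqP.
Qed.

Lemma A_split : A = dil 4 A + q * dil 8 psi.
Proof.
apply: cf2_inj; have h := phi_split; rewrite phiE dilD dil1 // dil_natM in h.
have -> : 2 * A = 1 + 2 * A - 1 by ring.
by rewrite h; ring.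
Qed.

Lemma A3_split : A3 = dil 4 A3 + q ^+ 3 * dil 24 psi.
Proof.
have d1 : dil 3 (dil 4 A) = dil 4 A3 by rewrite !dil_dil.
have d2 : dil 3 (dil 8 psi) = dil 24 psi by rewrite dil_dil.
have d3 : dil 3 q = q ^+ 3 by rewrite dil_qm // -qmE.
by rewrite -d1 -d2 -d3 -(dilM (isT : (0 < 3)%N)) -dilD -A_split.
Qed.

Section Mod2.
Let x := r2 f1.
Let y := r2 (f 3).
Let V := r2 (A + A3).

Lemma r2_f2k k : (0 < k)%N -> r2 (f (2 * k)) = r2 (f k) ^+ 2.
Proof. by move=> k0; rewrite -r2_dil2 dil_f. Qed.

Lemma r2_psi_k k : (0 < k)%N -> r2 (dil k psi) = r2 (f k) ^+ 3.
Proof.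
move=> k0; have c : cf (r2 (f k)) 0 = 1 by rewrite r2_const ?cf_f.
apply: (fps_mulI c); rewrite mulrC -rmorphM psi_f // rmorphXn /= r2_f2k //; ring.
Qed.

Lemma r2_q : r2 q = qm 1. Proof. exact: mapf_qm. Qed.

Lemma r2_phi k : (0 < k)%N -> r2 (dil k phi) = 1.
Proof.
by move=> k0; rewrite phiE dilD dil1 // dil_natM rmorphD rmorphM rmorph1
  rmorph_nat two_F2 mul0r addr0.
Qed.

(** This is [psi_psi3] with [phi = 1] and [psi = f_1^3], both valid modulo 2, and dilations by 2
    read as squares. *)
Lemma r2_pp : x ^+ 3 * y ^+ 3 = x ^+ 12 + qm 1 * y ^+ 12.
Proof.
have := congr1 r2 psi_psi3; rewrite rmorphD !rmorphM /= r2_q -[psi]dil_id.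
rewrite !dil_dil // !r2_psi_k // !r2_phi // f_1 mulr1 mulr1.
have e4 : r2 (f 4) = r2 (f 2) ^+ 2 := @r2_f2k 2 isT.
have e2 : r2 (f 2) = r2 (f 1) ^+ 2 := @r2_f2k 1 isT.
have e12 : r2 (f 12) = r2 (f 6) ^+ 2 := @r2_f2k 6 isT.
have e6 : r2 (f 6) = r2 (f 3) ^+ 2 := @r2_f2k 3 isT.
rewrite e4 e2 e12 e6 f_1 -/x -/y => h.
by rewrite h; ring.
Qed.

Lemma r2_f8 : r2 (f 8) = x ^+ 8.
Proof.
have e8 : r2 (f 8) = r2 (f 4) ^+ 2 := @r2_f2k 4 isT.
have e4 : r2 (f 4) = r2 (f 2) ^+ 2 := @r2_f2k 2 isT.
have e2 : r2 (f 2) = r2 (f 1) ^+ 2 := @r2_f2k 1 isT.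
by rewrite e8 e4 e2 f_1 -/x; ring.
Qed.

Lemma r2_f24 : r2 (f 24) = y ^+ 8.
Proof.
have e8 : r2 (f 24) = r2 (f 12) ^+ 2 := @r2_f2k 12 isT.
have e4 : r2 (f 12) = r2 (f 6) ^+ 2 := @r2_f2k 6 isT.
have e2 : r2 (f 6) = r2 (f 3) ^+ 2 := @r2_f2k 3 isT.
by rewrite e8 e4 e2 -/y; ring.
Qed.

(** Modulo 2, [A_split] and [A3_split] express [A] and [A3] by their fourth powers; the remainders
    [q x^24] and [q^3 y^24] add up to [q] times the square of [r2_pp]. *)
Lemma V_eq : V = V ^+ 4 + qm 1 * (x ^+ 6 * y ^+ 6).
Proof.
have e4 a : r2 (dil 4 a) = r2 a ^+ 4.
  by rewrite -(@dil_dil _ 2 2) // !r2_dil2 -exprM.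
have eA : r2 A = r2 A ^+ 4 + qm 1 * x ^+ 24.
  rewrite {1}A_split rmorphD rmorphM /= e4 r2_q r2_psi_k //.
  by rewrite r2_f8; ring.
have eA3 : r2 A3 = r2 A3 ^+ 4 + qm 1 * (qm 1 ^+ 2 * y ^+ 24).
  rewrite {1}A3_split rmorphD rmorphM rmorphXn /= e4 r2_q.
  have -> : r2 (dil 24 psi) = y ^+ 24 by rewrite r2_psi_k // r2_f24 -exprM.
  by ring.
have h := congr1 (fun z => z ^+ 2) r2_pp; rewrite /= in h.
have h' : x ^+ 6 * y ^+ 6 = x ^+ 24 + qm 1 ^+ 2 * y ^+ 24.
  transitivity ((x ^+ 3 * y ^+ 3) ^+ 2); first by ring.
  rewrite h [LHS](_ : _ = x ^+ 24 + qm 1 ^+ 2 * y ^+ 24 +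
    2%:R * (qm 1 * x ^+ 12 * y ^+ 12)); last by ring.
  by rewrite two_F2 mul0r addr0.
have e2 (a b : fps 'F_2) : (a + b) ^+ 2 = a ^+ 2 + b ^+ 2.
  rewrite [LHS](_ : _ = a ^+ 2 + b ^+ 2 + 2%:R * (a * b)); last by ring.
  by rewrite two_F2 mul0r addr0.
have eV : V ^+ 4 = r2 A ^+ 4 + r2 A3 ^+ 4.
  by rewrite /V rmorphD /= (exprM _ 2 2) !e2 -!exprM.
by rewrite eV h' {1}/V rmorphD /= {1}eA {1}eA3; ring.
Qed.

(* Both sides are solutions of Y = q x^6 y^6 + Y^2 without constant term. *)
Lemma theta_cube_mod2 :
  r2 (q * f1 * i2 ^+ 2 * s ^+ 3) = V + V ^+ 2.
Proof.
have cx : cf x 0 = 1 by rewrite r2_const ?cf_f1.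
pose i := fps_inv x; have xi : x * i = 1 := fps_invP cx.
have -> : r2 (q * f1 * i2 ^+ 2 * s ^+ 3) = qm 1 * y ^+ 9 * i ^+ 3.
  have c4 : cf (x ^+ 4) 0 = 1 by rewrite cf_expr0.
  have h : r2 i2 * x ^+ 2 = 1.
    have e2 : r2 (f 2) = x ^+ 2 by rewrite /x -f_1; exact: (@r2_f2k 1 isT).
    by rewrite -e2 -rmorphM mulrC fps_invP ?cf_f // rmorph1.
  rewrite 3!rmorphM !rmorphXn /= r2_q r2_psi_k // -/x -/y.
  apply: (fps_mulI c4).
  transitivity (qm 1 * x * (r2 i2 * x ^+ 2) ^+ 2 * y ^+ 9); first by ring.
  transitivity (qm 1 * x * (x * i) ^+ 3 * y ^+ 9); last by ring.
  by rewrite h xi; ring.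
set Y := qm 1 * y ^+ 9 * i ^+ 3.
have eY : Y = Y ^+ 2 + qm 1 * (x ^+ 6 * y ^+ 6).
  transitivity (qm 1 * y ^+ 9 * i ^+ 3 * (x * i) ^+ 3); first by rewrite xi /Y; ring.
  transitivity (qm 1 * y ^+ 6 * i ^+ 6 * (x ^+ 3 * y ^+ 3)); first by ring.
  rewrite r2_pp.
  transitivity (Y ^+ 2 + qm 1 * (x ^+ 6 * y ^+ 6) * (x * i) ^+ 6);
    first by rewrite /Y; ring.
  by rewrite xi; ring.
(* Squaring is additive here, so the difference of the two solutions is idempotent; having constant
   coefficient 0, it vanishes. *)
pose D := Y - (V + V ^+ 2).
have eD : D ^+ 2 = D.
  have e : D ^+ 2 - D = (Y ^+ 2 + qm 1 * (x ^+ 6 * y ^+ 6) - Y) +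
     (V ^+ 4 + qm 1 * (x ^+ 6 * y ^+ 6) - V) +
     2%:R * (V ^+ 2 + V ^+ 3 + V - Y * (V + V ^+ 2) - qm 1 * (x ^+ 6 * y ^+ 6)).
    by rewrite /D; ring.
  by apply/eqP; rewrite -subr_eq0 e -eY -V_eq two_F2 !subrr mul0r !addr0.
have cV : cf V 0 = 0.
  by rewrite /V /r2 cf_mapf cfD cf_dil_gt0 // cf_A.
have cD : cf (1 - D) 0 = 1.
  rewrite cfB cf1 cfB cfD expr2 cfM0 cV /Y -mulrA cf_qmM /=.
  by rewrite mul0r !addr0 !subr0.
suff D0 : D = 0 by apply/eqP; rewrite -subr_eq0 -/D D0.
apply: (fps_mulI cD); rewrite mulr0 mulrBl mul1r -expr2 eD; exact: subrr.
Qed.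
End Mod2.

(** Half of [ph * p3 - 1]. *)
Definition rho : fz := neg A + neg A3 + 2 * (neg A * neg A3).

(** The factor [ph], which can be cancelled later, removes [g] through [ph * g = f1 * p3]. In
    [n0_mod8] there then remains [f1] times a polynomial in [a], [b] and [Y], where [Y] comes with
    the factor 12, so that its value modulo 2 from [theta_cube_mod2] suffices. *)
Lemma n0_mod4 : exists w, ph * n0 = ph * (3 * f1 * rho) + 4 * w.
Proof.
pose a := neg A; pose b := neg A3; pose t := a + a ^+ 2 + b + b ^+ 2.
pose Y := q * f1 * i2 ^+ 2 * s ^+ 3.
have [w1 eY] : exists w, Y = t + 2 * w.
  apply: r2_lift; rewrite theta_cube_mod2 /t.
  have rn z : r2 (neg z) = r2 z by rewrite /r2 mapf_neg neg_F2.
  rewrite !rmorphD !rmorphXn /= /a /b !rn.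
  rewrite [LHS](_ : _ = r2 A + r2 A ^+ 2 + r2 A3 + r2 A3 ^+ 2 +
    2%:R * (r2 A * r2 A3)); last by ring.
  by rewrite two_F2 mul0r addr0.
have [w2 e8] := n0_mod8.
have eg : ph * g = f1 * p3.
  have c : cf (f1 * f 2) 0 = 1 by rewrite cfM0 cf_f1 cf_f.
  apply: (fps_mulI c); transitivity ((ph * f 2) * (f1 * g)); first by ring.
  by rewrite ph_f2 g_f; ring.
have ec : c0 = p3 ^+ 2 * g + 4 * (f1 * Y) by rewrite c0E /Y; ring.
(* One eighth of what is left of the doubled equation when [ph = 1 + 2a], [p3 = 1 + 2b] and
   [Y = t + 2 w1] are expanded. *)
exists (f1 * ((a - b) - 3 * (1 + a + b) * t - 3 * ph * w1) + ph * w2).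
apply: cf2_inj; transitivity (ph * (2 * n0)); first by ring.
rewrite e8 ec; transitivity (ph * f1 + 2 * (ph * g) - 3 * p3 ^+ 2 * (ph * g)
  - 12 * ph * f1 * Y + 8 * ph * w2); first by ring.
rewrite eg eY /rho p3E phE -/a -/b /t; ring.
Qed.

(** * Bisections modulo 4 *)

Definition pp : fz := psi * dil 3 psi.

Lemma neg_pp : neg pp = dil 4 psi * dil 6 phi - q * dil 2 phi * dil 12 psi.
Proof.
by rewrite /pp psi_psi3 negD !negM neg_q !neg_dil2 //; ring.
Qed.

(** By [psi_psi3], [pp * neg pp] is a difference of two squares; the product formulas show that it
    is the left side at [q^2]. *)
Lemma prod_f1236 : f1 * f 2 * f 3 * f 6 =
  dil 2 psi ^+ 2 * dil 3 phi ^+ 2 - q * phi ^+ 2 * dil 6 psi ^+ 2.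
Proof.
have c : cf (f1 * f 3 * f 2 * f 6) 0 = 1 by rewrite !cfM0 cf_f1 !cf_f.
have e1 : pp * neg pp = f 2 * f 4 * f 6 * f 12.
  apply: (fps_mulI c).
  transitivity ((psi * f1) * (s * f 3) * ((neg psi * f 2) * (dil 3 (neg psi) * f 6))).
    by rewrite /pp negM neg_dil_odd //; ring.
  rewrite psi_f1 (@psi_f 3) // neg_psi.
  have -> : dil 3 (neg psi) * f 6 = f 3 * f 12.
    rewrite -[f 6](@dil_f 3 2) // -dilM // neg_psi dilM // dil_f //.
  rewrite -[(2 * 3)%N]/6%N; ring.
apply: (@dil_inj _ 2) => //.
rewrite !(dil_nat, dilB, dilM, dilX, dil_dil, dil_f, dil_qm) //.
rewrite -/(f 2) (qmE _ (2 * 1)) /= -[(2 * 2)%N]/4%N -[(2 * 3)%N]/6%N -[(2 * 6)%N]/12%N.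
transitivity (pp * neg pp); first by rewrite e1.
rewrite neg_pp /pp psi_psi3; ring.
Qed.

(** Half of [phi * dil 3 phi - 1]; at [-q] it becomes [rho]. *)
Definition rser : fz := A + A3 + 2 * (A * A3).

Lemma rser_split : rser = dil 4 rser + q * dil 2 pp + 2 * (q ^+ 4 * dil 8 pp).
Proof.
have e3 : A3 = dil 12 A + q ^+ 3 * dil 24 psi by rewrite {1}A3_split dil_dil.
have d4 : dil 4 rser = dil 4 A + dil 12 A + 2 * (dil 4 A * dil 12 A).
  by rewrite /rser dilD [dil 4 (2 * _)]dil_natM dilD dilM // dil_dil.
have d8 : dil 8 pp = dil 8 psi * dil 24 psi by rewrite /pp dilM // dil_dil.
have dphi k : (0 < k)%N -> dil k phi = 1 + 2 * dil k A.
  by move=> k0; rewrite phiE dilD dil1 // dil_natM.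
have d2 : dil 2 pp = dil 8 psi * dil 12 phi + q ^+ 2 * dil 4 phi * dil 24 psi.
  by rewrite /pp psi_psi3 dilD !dilM // !dil_dil // dil_qm // (qmE _ (2 * 1)).
rewrite d4 d8 d2 !dphi //.
transitivity (dil 4 A + q * dil 8 psi + (dil 12 A + q ^+ 3 * dil 24 psi) +
  2 * ((dil 4 A + q * dil 8 psi) * (dil 12 A + q ^+ 3 * dil 24 psi))).
  by rewrite -A_split -e3.
by ring.
Qed.

Lemma neg_rser : neg rser = rho.
Proof. by rewrite /rser !negD neg_natM negM. Qed.

Definition r4 : fz -> fps 'Z_4 := mapf [the {rmorphism int -> 'Z_4} of intmul 1].
HB.instance Definition _ := GRing.RMorphism.on r4.

Lemma r4_const a : cf a 0 = 1 -> cf (r4 a) 0 = 1.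
Proof. by move=> e; rewrite cf_mapf e rmorph1. Qed.

Lemma four0 : 4%:R = 0 :> fps 'Z_4.
Proof. by apply: fpsP => n; rewrite cf_nat cf0; case: ifP => // _; apply: val_inj. Qed.

Lemma r4_dil k a : r4 (dil k a) = dil k (r4 a). Proof. exact: mapf_dil. Qed.
Lemma r4_q : r4 q = qm 1. Proof. exact: mapf_qm. Qed.
Lemma r4_neg a : r4 (neg a) = neg (r4 a). Proof. exact: mapf_neg. Qed.

Lemma neg2_Z4 (a : fps 'Z_4) : 2%:R * neg a = 2%:R * a.
Proof.
apply: fpsP => n; rewrite !cf_natM cf_scalE -signr_odd; case: (odd n).
  by rewrite expr1 mulN1r; case: (cf a n) => -[|[|[|[|]]]] // ?; apply: val_inj.
by rewrite mul1r.
Qed.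

Section Sec2.
Variable R : comNzRingType.
Implicit Types a b : fps R.

Lemma sec20M a b : sec 2 0 (a * b) =
  sec 2 0 a * sec 2 0 b + qm 1 * (sec 2 1 a * sec 2 1 b).
Proof.
rewrite {1}[a]sec_split2 mulrDl secD sec_dilM //; congr (_ + _).
by rewrite -mulrA sec0_qM sec_dilM.
Qed.

Lemma sec21M a b : sec 2 1 (a * b) =
  sec 2 0 a * sec 2 1 b + sec 2 1 a * sec 2 0 b.
Proof.
rewrite {1}[a]sec_split2 mulrDl secD sec_dilM //; congr (_ + _).
by rewrite -mulrA sec_qM sec_dilM.
Qed.

Lemma sec21_dil a : sec 2 1 (dil 2 a) = 0. Proof. by rewrite sec_dil. Qed.
Lemma sec20_dil a : sec 2 0 (dil 2 a) = a. Proof. by rewrite sec_dil. Qed.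
Lemma sec20q a : sec 2 0 (qm 1 * a) = qm 1 * sec 2 1 a. Proof. exact: sec0_qM. Qed.
Lemma sec21q a : sec 2 1 (qm 1 * a) = sec 2 0 a. Proof. exact: sec_qM. Qed.
Lemma sec_one r : (r < 2)%N -> sec 2 r (1 : fps R) = (r == 0%N)%:R.
Proof. by move=> r2; rewrite -[in LHS](dil1 R (isT : (0 < 2)%N)) sec_dil //; case: eqP. Qed.
End Sec2.

(** * Dissections modulo 4 in terms of [f_1] and [f_3] *)

Section Mod4.
Local Notation z := (qm 1 : fps 'Z_4).
Let x := r4 f1.
Let y := r4 (f 3).
Let P := r4 ph * r4 p3.
Let i := fps_inv x.
Let r := r4 rser.
Let p := r4 pp.
Let b := y ^+ 3 * i.

Lemma sqr_ph4 : r4 ph ^+ 2 = 1.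
Proof.
rewrite phE rmorphD rmorphM rmorph1 rmorph_nat /=.
rewrite [LHS](_ : _ = 1 + 4%:R * (r4 (neg A) + r4 (neg A) ^+ 2)); last by ring.
by rewrite four0 mul0r addr0.
Qed.

Lemma sqr_phk4 k : (0 < k)%N -> r4 (dil k ph) ^+ 2 = 1.
Proof. by move=> k0; rewrite r4_dil -dilX // sqr_ph4 dil1. Qed.

Lemma sqr_P : P ^+ 2 = 1.
Proof. by rewrite exprMn sqr_ph4 sqr_phk4 // mulr1. Qed.

Lemma f2k4 k : (0 < k)%N -> r4 (f (2 * k)) = r4 (dil k ph) * r4 (f k) ^+ 2.
Proof.
move=> k0; rewrite -rmorphXn -ph_f // rmorphM mulrA -expr2 sqr_phk4 //.
by rewrite mul1r.
Qed.

Lemma psik4 k : (0 < k)%N -> r4 (dil k psi) = r4 (f k) ^+ 3.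
Proof.
move=> k0; have c : cf (r4 (f k)) 0 = 1 by rewrite r4_const ?cf_f.
apply: (fps_mulI c); rewrite mulrC -rmorphM psi_f // rmorphXn /= f2k4 //.
by rewrite exprMn sqr_phk4 // mul1r; ring.
Qed.

Lemma phi4 : r4 phi = r4 ph.
Proof.
rewrite phE phiE !rmorphD !rmorphM rmorph_nat /= r4_neg.
by rewrite neg2_Z4.
Qed.

Lemma F2E : r4 (f 2) = r4 ph * x ^+ 2.
Proof. by rewrite (f2k4 (k := 1)) // dil_id f_1. Qed.
Lemma F6E : r4 (f 6) = r4 p3 * y ^+ 2.
Proof. by rewrite (f2k4 (k := 3)). Qed.

Lemma ppE : p = x ^+ 3 * y ^+ 3.
Proof. by rewrite /p /pp rmorphM /= -[X in r4 X * _]dil_id !psik4 // f_1. Qed.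

Lemma xi : x * i = 1.
Proof. by rewrite fps_invP // r4_const ?cf_f1. Qed.

Lemma PE : P = 1 + 2 * r.
Proof.
rewrite /P -phi4 r4_dil -phi4 -r4_dil -rmorphM /= /r.
have -> : phi * dil 3 phi = 1 + 2 * rser.
  by rewrite phiE dilD dil1 // dil_natM /rser; ring.
by rewrite rmorphD rmorphM rmorph1 rmorph_nat.
Qed.

(** This is [prod_f1236] modulo 4, where even powers of [ph] and [p3] drop out. *)
Lemma x12E : x ^+ 12 = P * x ^+ 3 * y ^+ 3 + z * y ^+ 12.
Proof.
have := congr1 r4 prod_f1236.
rewrite !(rmorphXn, rmorphM, rmorphB) /= r4_q !psik4 // F2E F6E -/x -/y.
have -> : r4 (dil 3 phi) = r4 p3 by rewrite r4_dil phi4 -r4_dil.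
rewrite phi4 sqr_ph4 sqr_phk4 //.
set u := r4 ph; set v := r4 p3 => h.
have hu : u ^+ 6 = 1 by rewrite (exprM u 2 3) sqr_ph4 expr1n.
have hv : v ^+ 6 = 1 by rewrite (exprM v 2 3) sqr_phk4 // expr1n.
have -> : P * x ^+ 3 * y ^+ 3 = x * (u * x ^+ 2) * y * (v * y ^+ 2).
  by rewrite /P -/u -/v; ring.
rewrite h; transitivity (u ^+ 6 * x ^+ 12 - z * v ^+ 6 * y ^+ 12 + z * y ^+ 12);
  last by ring.
by rewrite hu hv; ring.
Qed.

Lemma p_split : p = dil 2 (P * x ^+ 6) + z * dil 2 (P * y ^+ 6).
Proof.
have dd k m a : (0 < k)%N -> (0 < m)%N -> r4 (dil (k * m) a) = dil k (r4 (dil m a)).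
  by move=> k0 m0; rewrite -r4_dil dil_dil.
have d1 : r4 (dil 4 psi) = dil 2 (r4 (dil 2 psi)) := @dd 2 2 psi isT isT.
have d2 : r4 (dil 6 phi) = dil 2 (r4 p3).
  by rewrite [r4 p3]r4_dil -phi4 -r4_dil; exact: (@dd 2 3 phi isT isT).
have d3 : r4 (dil 2 phi) = dil 2 (r4 ph) by rewrite r4_dil phi4.
have d4 : r4 (dil 12 psi) = dil 2 (r4 (dil 6 psi)) := @dd 2 6 psi isT isT.
rewrite /p /pp psi_psi3 rmorphD 3!rmorphM /= r4_q d1 d2 d3 d4 -dilM // -mulrA.
rewrite -dilM // !psik4 // F2E F6E /P.
have := sqr_ph4; have := @sqr_phk4 3 isT; set u := r4 ph; set v := r4 p3 => hv hu.
congr (dil 2 _ + z * dil 2 _).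
  transitivity (u ^+ 2 * u * v * x ^+ 6); first by ring.
  by rewrite hu mul1r.
transitivity (v ^+ 2 * u * v * y ^+ 6); first by ring.
by rewrite hv mul1r.
Qed.

Lemma p20 : sec 2 0 p = P * x ^+ 6.
Proof. by rewrite p_split secD sec20q sec20_dil sec21_dil mulr0 addr0. Qed.

Lemma p21 : sec 2 1 p = P * y ^+ 6.
Proof. by rewrite p_split secD sec21q sec20_dil sec21_dil add0r. Qed.

(** The even section of [r]. That it is itself a series in [q^2] is what permits repeated
    bisection. *)
Definition r20 : fps 'Z_4 := dil 2 (r + 2 * (z * dil 2 p)).

Lemma r_split : r = dil 2 r20 + z * dil 2 p.
Proof.
have e : r20 = r4 (dil 2 rser + 2 * (q ^+ 2 * dil 4 pp)).
  rewrite /r20 dilD dil_natM dilM // dil_dil // dil_qm // (qmE _ (2 * 1)).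
  rewrite rmorphD 2!rmorphM rmorphXn rmorph_nat /= r4_q.
  by rewrite !r4_dil.
rewrite e -!r4_dil -r4_q /r -rmorphM -rmorphD; congr r4.
rewrite {1}rser_split dilD dil_natM dilM // !dil_dil // dilX //.
by rewrite dil_qm // (qmE _ (2 * 1)) -[(2 * 2)%N]/4%N -[(2 * 4)%N]/8%N; ring.
Qed.

Lemma rsec0 : sec 2 0 r = r20.
Proof. by rewrite r_split secD sec20q sec20_dil sec21_dil mulr0 addr0. Qed.

Lemma rsec1 : sec 2 1 r = p.
Proof. by rewrite r_split secD sec21q sec20_dil sec21_dil add0r. Qed.

Lemma rho0 : sec 2 0 (r4 rho) = r20.
Proof. by rewrite -neg_rser r4_neg sec_neg0 -/r rsec0. Qed.
Lemma rho1 : sec 2 1 (r4 rho) = - p.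
Proof. by rewrite -neg_rser r4_neg sec_neg1 -/r rsec1. Qed.
Lemma rhoP : P = 1 + 2 * r4 rho.
Proof. by rewrite PE -neg_rser r4_neg neg2_Z4. Qed.

Definition zser := r4 (sec 3 0 PDtser).

Lemma n04 : r4 n0 = 3 * x * r4 rho.
Proof.
have [w h] := n0_mod4.
have c : cf (r4 ph) 0 = 1.
  rewrite r4_const // phE cfD cf_natM cf1 cf_scalE expr0 mul1r cf_A; exact: addr0.
apply: (fps_mulI c); rewrite -rmorphM h rmorphD !rmorphM !rmorph_nat /=.
by rewrite four0 mul0r addr0.
Qed.

(** Modulo 4, [c0 = g = P x], [psi(q^3) = y^3] and -27 is 1. Hence the divisor in [PDt3_main],
    multiplied by [y^3], is the right side of [x12E]. *)
Lemma zserE : zser * x ^+ 12 = x ^+ 12 - p + p * r4 rho.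
Proof.
have h := congr1 r4 PDt3_main.
have u2 := sqr_ph4; have v2 := @sqr_phk4 3 isT.
have gx : x * r4 g = r4 p3 * r4 ph * x ^+ 2.
  by rewrite -rmorphM g_f rmorphM /= F2E; ring.
have gE : r4 g = P * x.
  apply: (fps_mulI (c := x)); first by rewrite r4_const ?cf_f1.
  by rewrite gx /P; ring.
have cE : r4 c0 = r4 g.
  rewrite c0E rmorphD rmorphM rmorphXn (rmorphM _ 4%:R) rmorph_nat /= v2.
  by rewrite four0 mul0r addr0 mul1r.
rewrite !(rmorph_nat, rmorphXn, rmorphM, rmorphB, rmorphD) /= -/zser cE in h.
rewrite psik4 // n04 gE r4_q -/y in h.
have P2' := sqr_P; have P3 : P ^+ 3 = P by rewrite exprS sqr_P mulr1.
rewrite exprMn P3 exprMn P2' in h.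
transitivity (y ^+ 3 * (zser * (P * x ^+ 3 - 27%:R * z * y ^+ 9)) +
   4%:R * (7%:R * zser * z * y ^+ 12)).
  by rewrite x12E; ring.
have x12 := x12E; rewrite rhoP in x12.
rewrite h ppE x12; set ro := r4 rho.
transitivity (((1 + 2 * ro) * x ^+ 3 * y ^+ 3 + z * y ^+ 12) - x ^+ 3 * y ^+ 3
  + x ^+ 3 * y ^+ 3 * ro + 4%:R * (7%:R * zser * z * y ^+ 12 + 2 * z * y ^+ 12));
  last by rewrite four0; ring.
by ring.
Qed.

Lemma rmul4 (a : fps 'Z_4) : 4%:R * a = 0. Proof. by rewrite four0 mul0r. Qed.

Lemma dil2x : dil 2 x = r4 ph * x ^+ 2.
Proof. by rewrite -r4_dil -/(f 2) F2E. Qed.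
Lemma dil2y : dil 2 y = r4 p3 * y ^+ 2.
Proof. by rewrite -r4_dil dil_f // F6E. Qed.
Lemma dil2i : dil 2 i = r4 ph * i ^+ 2.
Proof.
have c : cf (dil 2 x) 0 = 1 by rewrite cf_dil_gt0 // r4_const ?cf_f1.
apply: (fps_mulI c); rewrite -dilM // xi dil1 // dil2x.
transitivity (r4 ph ^+ 2 * (x * i) ^+ 2); last by ring.
by rewrite sqr_ph4 xi; ring.
Qed.

Lemma dil2x6 : dil 2 (x ^+ 6) = x ^+ 12.
Proof.
rewrite dilX // dil2x; transitivity ((r4 ph ^+ 2) ^+ 3 * x ^+ 12); first by ring.
by rewrite sqr_ph4; ring.
Qed.

Lemma dil2y6 : dil 2 (y ^+ 6) = y ^+ 12.
Proof.
rewrite dilX // dil2y; transitivity ((r4 p3 ^+ 2) ^+ 3 * y ^+ 12); first by ring.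
by rewrite (@sqr_phk4 3) //; ring.
Qed.

Lemma dil2b : dil 2 b = P * y ^+ 6 * i ^+ 2.
Proof.
rewrite /b dilM // dilX // dil2y dil2i /P.
transitivity (r4 p3 ^+ 2 * (r4 ph * r4 p3 * y ^+ 6 * i ^+ 2)); first by ring.
by rewrite (@sqr_phk4 3) // mul1r.
Qed.

(** Up to a series in [q^2], the quotient [f_3^3 / f_1] is [p], so its sections can be read off from
    [p20] and [p21]. *)
Lemma b_p : b = dil 2 (i ^+ 2) * p.
Proof.
rewrite dilX // dil2i ppE /b.
transitivity (r4 ph ^+ 2 * y ^+ 3 * i * (x * i) ^+ 3); last by ring.
by rewrite sqr_ph4 xi; ring.
Qed.

Lemma b20 : sec 2 0 b = P * x ^+ 4.
Proof.
rewrite b_p sec_dilM // p20; transitivity (P * x ^+ 4 * (x * i) ^+ 2); first by ring.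
by rewrite xi; ring.
Qed.

Lemma b21 : sec 2 1 b = dil 2 b.
Proof. by rewrite b_p sec_dilM // p21 -b_p dil2b; ring. Qed.

Lemma bP : b * (P * x ^+ 4) = P * p.
Proof.
rewrite ppE /b; transitivity (P * x ^+ 3 * y ^+ 3 * (x * i)); first by ring.
by rewrite xi; ring.
Qed.

Local Notation W := (r + 2 * (z * dil 2 p)).

Definition ze := sec 2 0 zser.
Definition zo := sec 2 1 zser.

Lemma cx k : cf (x ^+ k) 0 = 1.
Proof. by rewrite cf_expr0 // r4_const ?cf_f1. Qed.

Lemma zser_dil : dil 2 (x ^+ 6) * zser = dil 2 (x ^+ 6) - p + p * r4 rho.
Proof. by rewrite dil2x6 mulrC zserE. Qed.

Lemma zeE : ze = r20 + 2 * r + 2 * (r * r20) - z * (b * dil 2 b).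
Proof.
have := congr1 (sec 2 0) zser_dil.
rewrite sec_dilM // secD secB sec20_dil sec20M p20 p21 rho0 rho1 -/ze => h.
apply: (fps_mulI (cx 6)); rewrite h dil2b ppE /b.
transitivity (x ^+ 6 - P * x ^+ 6 + P * x ^+ 6 * r20
  - z * (P * y ^+ 9 * x ^+ 3 * (x * i) ^+ 3)); first by rewrite xi; ring.
transitivity (x ^+ 6 * (r20 + 2 * r + 2 * (r * r20)) - x ^+ 6 * (4%:R * r)
  - z * (P * y ^+ 9 * x ^+ 3 * (x * i) ^+ 3)); first by rewrite PE; ring.
by rewrite rmul4; ring.
Qed.

Lemma sec_bb0 : sec 2 0 (b * dil 2 b) = P * p.
Proof. by rewrite mulrC sec_dilM // b20 bP. Qed.

(** Because of this reproduction the last term of [zeE] is fixed by even sections, which leads to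
    the periodicity [zee0]. *)
Lemma sec_bb1 : sec 2 1 (b * dil 2 b) = b * dil 2 b.
Proof. by rewrite mulrC sec_dilM // b21 mulrC. Qed.

Lemma sec_r r' a : (r' < 2)%N -> sec 2 r' (a * r20) = W * sec 2 r' a.
Proof. by move=> h; rewrite /r20 mulrC sec_dilM. Qed.

Lemma ze1 : sec 2 1 ze = p.
Proof.
rewrite zeE secB !secD !sec_natmul sec21q sec_bb0 sec_r // rsec1 sec21_dil PE.
transitivity (p + 4%:R * (z * dil 2 p * p)); first by ring.
by rewrite rmul4 addr0.
Qed.

Lemma zeeE : sec 2 0 ze = W + 2 * (1 + r) * r20 - z * (b * dil 2 b).
Proof.
rewrite zeE secB !secD !sec_natmul sec20q sec_bb1 sec_r // rsec0 sec20_dil.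
transitivity (W + 2 * (1 + r) * r20 - z * (b * dil 2 b)
   + 4%:R * (z * dil 2 p * r20)); first by ring.
by rewrite rmul4 addr0.
Qed.

Lemma zee1 : sec 2 1 (sec 2 0 ze) = 2 * p.
Proof.
rewrite zeeE secB !secD -mulrA !sec_natmul !sec21q sec_bb0 sec_r // secD rsec1.
rewrite sec_one //= mulr0n sec20_dil PE.
transitivity (2 * p + 4%:R * (z * dil 2 p * p)); first by ring.
by rewrite rmul4 addr0.
Qed.

Lemma zee0 : sec 2 0 (sec 2 0 ze) = ze.
Proof.
rewrite zeeE secB !secD -mulrA !sec_natmul !sec20q sec_bb1 sec_r // secD rsec0.
rewrite sec_one //= sec21_dil zeE.
transitivity (r20 + 2 * r + 2 * (r * r20) - z * (b * dil 2 b)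
   + 4%:R * (z * dil 2 p * (1 + r20))); first by ring.
by rewrite rmul4 addr0.
Qed.

Lemma zo1 : sec 2 1 zo = y ^+ 6.
Proof.
have := congr1 (sec 2 1) zser_dil.
rewrite sec_dilM // secD secB sec21_dil sec21M p20 p21 rho0 rho1 -/zo => h.
have e : zo = dil 2 (y ^+ 3 * i ^+ 3 * (W - 1)) - P * p.
  apply: (fps_mulI (cx 6)); rewrite h dilM // dilM // !dilX // dilB dil1 // -/r20.
  rewrite dil2y dil2i; have := sqr_ph4; have := @sqr_phk4 3 isT.
  rewrite /P; set u := r4 ph; set v := r4 p3 => hv hu.
  transitivity ((v ^+ 2) * v * (u ^+ 2 * u) * y ^+ 6 * (x * i) ^+ 6 * (r20 - 1)
     - u * v * x ^+ 6 * p); last by ring.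
  by rewrite hu hv xi; ring.
(* By [x12E] the product splits into an even and an odd part; the odd one alone contributes to the
   section. *)
have e' : P * p = dil 2 (x ^+ 6) - z * dil 2 (y ^+ 6).
  by rewrite dil2x6 dil2y6 x12E ppE; ring.
by rewrite e e' !secB sec21q !sec21_dil sec20_dil; ring.
Qed.
End Mod4.

(** * Congruences *)

Lemma r4_sec m r a : r4 (sec m r a) = sec m r (r4 a).
Proof. exact: mapf_sec. Qed.

Lemma PDt_cf n : (PDt n)%:R = cf (r4 PDtser) n :> 'Z_4.
Proof. by rewrite cf_mapf [cf PDtser n]/= rmorph_nat. Qed.

Definition cp n : 'Z_4 := cf (r4 pp) n.

Lemma PDt_12n6 n : (PDt (12 * n + 6))%:R = cp n.
Proof.
rewrite /cp -ze1 cf_secE /ze cf_secE /zser r4_sec cf_secE PDt_cf.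
by congr (cf _ _); lia.
Qed.

Lemma PDt_24n12 n : (PDt (24 * n + 12))%:R = 2 * cp n.
Proof.
rewrite /cp -cf_natM -zee1 /ze /zser r4_sec !cf_secE PDt_cf.
by congr (cf _ _); lia.
Qed.

Lemma PDt_24n n : (PDt (24 * n))%:R = (PDt (6 * n))%:R :> 'Z_4.
Proof.
have := congr1 (fun a => cf a n) zee0.
rewrite /ze /zser r4_sec !cf_secE !PDt_cf => h.
transitivity (cf (r4 PDtser) (3 * (2 * n + 0) + 0)); last by congr (cf _ _); lia.
by rewrite -h; congr (cf _ _); lia.
Qed.

Lemma PDt_12n9 n : (PDt (12 * n + 9))%:R = cf (r4 (f 3) ^+ 6) n.
Proof.
rewrite -zo1 cf_secE /zo cf_secE /zser r4_sec cf_secE PDt_cf.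
by congr (cf _ _); lia.
Qed.

Lemma cp_3n2 n : cp (3 * n + 2) = 0.
Proof.
have : sec 3 2 pp = 0 by rewrite /pp mulrC sec_dilM // sec32_th mulr0.
by move/(congr1 (fun a => cf a n)); rewrite /cp cf_mapf cf_secE => ->; rewrite rmorph0.
Qed.

(** The section turns [psi(q^3)] into [psi] and [psi] into [psi(q^3)]: the two factors of [pp]
    change places. *)
Lemma cp_3n1 n : cp (3 * n + 1) = cp n.
Proof.
have : sec 3 1 pp = pp by rewrite /pp mulrC sec_dilM // sec31_th mulrC.
by move/(congr1 (fun a => cf a n)); rewrite /cp cf_mapf cf_secE => ->.
Qed.

Lemma two_r4 (a w : fz) : r4 (2 * (a * (1 + 2 * w))) = 2 * r4 a.
Proof.
rewrite !(rmorph_nat, rmorphM, rmorphD, rmorph1).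
transitivity (2 * r4 a + 4%:R * (r4 a * r4 w)); first by ring.
by rewrite rmul4 addr0.
Qed.

(** As [phi] is 1 modulo 2, [psi_psi3] shows that [p(n)] is even unless [n] is [4T] or [12T + 1]
    with [T] triangular. *)
Lemma two_cp n : 2 * cp n = 2 * (cf (dil 4 psi) n + cf (q * dil 12 psi) n)%:~R.
Proof.
have dphi k : (0 < k)%N -> dil k phi = 1 + 2 * dil k aser.
  by move=> k0; rewrite phiE dilD dil1 // dil_natM.
have e : 2 * r4 pp = 2 * r4 (dil 4 psi + q * dil 12 psi).
  rewrite rmorphD mulrDr -(two_r4 (dil 4 psi) (dil 6 aser)).
  rewrite -(two_r4 (q * dil 12 psi) (dil 2 aser)) -!dphi // -rmorphD.
  transitivity (r4 (2 * pp)); first by rewrite [RHS]rmorphM /= [r4 2%:R]rmorph_nat.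
  by rewrite /pp psi_psi3; congr (r4 _); ring.
have := congr1 (fun a => cf a n) e; rewrite /= !cf_natM => ->.
by rewrite cf_mapf cfD.
Qed.

Lemma two_cp_mod4 n : (1 < n %% 4)%N -> 2 * cp n = 0.
Proof.
move=> h; rewrite two_cp cf_qmM !cf_dilE.
case: ifP => [|_]; first by lia.
case: ifP => [_|_]; last by rewrite addr0 rmorph0 mulr0.
by case: ifP => [|_]; [lia|rewrite addr0 rmorph0 mulr0].
Qed.

(** [6n+3] is odd and [6n+2] is not divisible by 3, so neither summand of [two_cp] contributes. *)
Lemma two_cp_6n3 n : 2 * cp (6 * n + 3) = 0.
Proof.
rewrite two_cp cf_qmM !cf_dilE.
case: ifP => [|_]; first by lia.
case: ifP => [_|_]; last by rewrite addr0 rmorph0 mulr0.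
by case: ifP => [|_]; [lia|rewrite addr0 rmorph0 mulr0].
Qed.

Lemma f3_6 n : (n %% 3 != 0)%N -> cf (r4 (f 3) ^+ 6) n = 0.
Proof.
by move=> h; rewrite -rmorphXn cf_mapf /f -dilX // cf_dilE ifN ?rmorph0 //; lia.
Qed.

(** Modulo 2, [f_3^6 = f_6^3 = psi(q^6)]. *)
Lemma two_f3_6 n : 2 * cf (r4 (f 3) ^+ 6) n = 2 * (cf (dil 6 psi) n)%:~R.
Proof.
have e : 2 * r4 (f 3) ^+ 6 = 2 * r4 (dil 6 psi).
  rewrite psik4 // F6E p3E rmorphD rmorphM rmorph1 rmorph_nat /=.
  set y := r4 (f 3); set w := r4 (neg _).
  transitivity (2 * y ^+ 6 + 4%:R * (y ^+ 6 * (3 * w + 6 * w ^+ 2 + 4 * w ^+ 3))).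
    by rewrite rmul4 addr0.
  by ring.
by have := congr1 (fun a => cf a n) e; rewrite /= !cf_natM => ->.
Qed.

Lemma PDt_eq4 a b : a%:R = b%:R :> 'Z_4 -> a = b %[mod 4].
Proof. by move/(congr1 val); rewrite /= !val_Zp_nat. Qed.

Lemma PDt_eq2 a : 2 * a%:R = 0 :> 'Z_4 -> a = 0 %[mod 2].
Proof.
rewrite -natrM => /(@PDt_eq4 _ 0) /eqP; rewrite mod0n -[4%N]/(2 * 2)%N.
by rewrite -muln_modr muln_eq0 /= => /eqP.
Qed.

Lemma PDt_4k k m : (PDt (2 ^ (2 * k) * (6 * m)))%:R = (PDt (6 * m))%:R :> 'Z_4.
Proof.
elim: k => [|k IH]; first by rewrite mul1n.
have -> : (2 ^ (2 * k.+1) * (6 * m) = 24 * (2 ^ (2 * k) * m))%N.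
  by rewrite mulnS expnD; lia.
by rewrite (PDt_24n (2 ^ (2 * k) * m)%N) -IH; congr (PDt _)%:R; lia.
Qed.

Lemma PDt_3l l n : (PDt (3 ^ l * (24 * n + 12)))%:R = (PDt (24 * n + 12))%:R :> 'Z_4.
Proof.
elim: l n => [|l IH] n; first by rewrite mul1n.
have -> : (3 ^ l.+1 * (24 * n + 12) = 3 ^ l * (24 * (3 * n + 1) + 12))%N.
  by rewrite expnS; lia.
by rewrite (IH (3 * n + 1)%N) (PDt_24n12 (3 * n + 1)%N) (PDt_24n12 n) cp_3n1.
Qed.

Lemma PDt_9k k n : (PDt (3 ^ (2 * k) * (12 * n + 6)))%:R = (PDt (12 * n + 6))%:R :> 'Z_4.
Proof.
elim: k n => [|k IH] n; first by rewrite mul1n.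
have -> : (3 ^ (2 * k.+1) * (12 * n + 6) = 3 ^ (2 * k) * (12 * (9 * n + 4) + 6))%N.
  by rewrite mulnS expnD; lia.
rewrite (IH (9 * n + 4)%N) (PDt_12n6 (9 * n + 4)%N) (PDt_12n6 n).
have -> : (9 * n + 4 = 3 * (3 * n + 1) + 1)%N by lia.
by rewrite !cp_3n1.
Qed.

Lemma PDt_24_12n6 a n : a = (2 * n + 1)%N -> (PDt (24 * a))%:R = cp n.
Proof. by move=> ->; rewrite (PDt_24n (2 * n + 1)%N) -PDt_12n6; congr (PDt _)%:R; lia. Qed.

Close Scope ring_scope.

Theorem theorem1p2 (k l n : nat) :
  (PDt (24 * n + 12) = 0 %[mod 2]) /\
  (PDt (24 * n + 21) = 0 %[mod 2]) /\
  (PDt (48 * n + 30) = 0 %[mod 2]) /\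
  (PDt (144 * n + 102) = 0 %[mod 2]) /\
  (PDt (216 * n + 153) = 0 %[mod 2]) /\
  (PDt (36 * n + 21) = 0 %[mod 4]) /\
  (PDt (36 * n + 33) = 0 %[mod 4]) /\
  (PDt (2 ^ (2 * k) * (12 * n)) = PDt (12 * n) %[mod 4]) /\
  (PDt (3 ^ l * 2 ^ (2 * k) * (24 * n + 12)) = PDt (24 * n + 12) %[mod 4]) /\
  (PDt (96 * n + 60) = 0 %[mod 4]) /\
  (PDt (96 * n + 84) = 0 %[mod 4]) /\
  (PDt (144 * n + 84) = 0 %[mod 4]) /\
  (PDt (144 * n + 120) = 0 %[mod 4]) /\
  (PDt (144 * n + 132) = 0 %[mod 4]) /\
  (PDt (3 ^ k * (288 * n + 204)) = PDt (288 * n + 204) %[mod 4]) /\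
  (PDt (288 * n + 204) = 0 %[mod 4]) /\
  (PDt (864 * n + 792) = 0 %[mod 4]) /\
  (PDt (1728 * n + 1224) = 0 %[mod 4]) /\
  (PDt (2592 * n + 1080) = 0 %[mod 4]) /\
  (PDt (36 * n + 30) = 0 %[mod 4]) /\
  (PDt (108 * n + 90) = 0 %[mod 4]) /\
  (PDt (3 ^ (2 * k) * (12 * n + 6)) = PDt (12 * n + 6) %[mod 4]).
Proof.
have cp0 a m : a = 3 * m + 2 -> cp a = 0%R by move=> ->; apply: cp_3n2.
have cp1 a m : a = 3 * m + 1 -> cp a = cp m by move=> ->; apply: cp_3n1.
have two0 : (2 * 0 = 0 :> 'Z_4)%R by rewrite GRing.mulr0.
have h12 : (PDt (144 * n + 132))%:R%R = 0%R :> 'Z_4.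
  have -> : 144 * n + 132 = 24 * (6 * n + 5) + 12 by lia.
  by rewrite PDt_24n12 (@cp0 _ (2 * n + 1)) //; lia.
have h204 : (PDt (288 * n + 204))%:R%R = 0%R :> 'Z_4.
  have -> : 288 * n + 204 = 24 * (12 * n + 8) + 12 by lia.
  by rewrite PDt_24n12 (@cp0 _ (4 * n + 2)) //; lia.
split; [apply: PDt_eq2|split; [apply: PDt_eq2|split; [apply: PDt_eq2|split;
  [apply: PDt_eq2|split; [apply: PDt_eq2|]]]]].
- rewrite PDt_24n12 GRing.mulrA -GRing.natrM.
  by rewrite (_ : (2 * 2)%:R%R = 0%R :> 'Z_4) ?GRing.mul0r //; apply: val_inj.
- have -> : 24 * n + 21 = 12 * (2 * n + 1) + 9 by lia.
  by rewrite PDt_12n9 two_f3_6 cf_dilE ifN //; lia.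
- have -> : 48 * n + 30 = 12 * (4 * n + 2) + 6 by lia.
  by rewrite PDt_12n6 two_cp_mod4 //; lia.
- have -> : 144 * n + 102 = 12 * (12 * n + 8) + 6 by lia.
  by rewrite PDt_12n6 (@cp0 _ (4 * n + 2)) //; lia.
- have -> : 216 * n + 153 = 12 * (18 * n + 12) + 9 by lia.
  (* The coefficient of [psi(q^6)] vanishes since no triangular number is 2 modulo 3. *)
  rewrite PDt_12n9 two_f3_6 (_ : 18 * n + 12 = 6 * (3 * n + 2)); last by lia.
  by rewrite cf_dil // -cf_secE sec32_th cf0.
(* The conjuncts for [144 * n + 132] and [288 * n + 204] are closed here by [h12] and [h204]. *)
do !split; apply: PDt_eq4 => //.
- have -> : 36 * n + 21 = 12 * (3 * n + 1) + 9 by lia.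
  by rewrite PDt_12n9 f3_6 //; lia.
- have -> : 36 * n + 33 = 12 * (3 * n + 2) + 9 by lia.
  by rewrite PDt_12n9 f3_6 //; lia.
- have -> : 12 * n = 6 * (2 * n) by lia.
  exact: PDt_4k.
(* Read backwards, [PDt_3l] puts the power of 3 on the right as well; [PDt_4k] then absorbs the
   power of 4. *)
- rewrite -(PDt_3l l n).
  have -> : 3 ^ l * (24 * n + 12) = 6 * (3 ^ l * (4 * n + 2)) by lia.
  by rewrite -(PDt_4k k); congr (PDt _)%:R%R; lia.
- have -> : 96 * n + 60 = 24 * (4 * n + 2) + 12 by lia.
  by rewrite PDt_24n12 two_cp_mod4 //; lia.
- have -> : 96 * n + 84 = 24 * (4 * n + 3) + 12 by lia.
  by rewrite PDt_24n12 two_cp_mod4 //; lia.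
- have -> : 144 * n + 84 = 24 * (6 * n + 3) + 12 by lia.
  by rewrite PDt_24n12 two_cp_6n3.
- have -> : 144 * n + 120 = 24 * (6 * n + 5) by lia.
  by rewrite (@PDt_24_12n6 _ (3 * n + 2)) ?cp_3n2 //; lia.
- have -> : 288 * n + 204 = 24 * (12 * n + 8) + 12 by lia.
  exact: PDt_3l.
(* From here on [cp1] is applied, where needed, until the index of [cp] is 2 modulo 3. *)
- have -> : 864 * n + 792 = 24 * (36 * n + 33) by lia.
  rewrite (@PDt_24_12n6 _ (18 * n + 16)) ?(@cp1 _ (6 * n + 5)); try by lia.
  by rewrite (@cp0 _ (2 * n + 1)) //; lia.
- have -> : 1728 * n + 1224 = 24 * (72 * n + 51) by lia.
  rewrite (@PDt_24_12n6 _ (36 * n + 25)) ?(@cp1 _ (12 * n + 8)); try by lia.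
  by rewrite (@cp0 _ (4 * n + 2)) //; lia.
- have -> : 2592 * n + 1080 = 24 * (108 * n + 45) by lia.
  rewrite (@PDt_24_12n6 _ (54 * n + 22)) ?(@cp1 _ (18 * n + 7)); try by lia.
  by rewrite (@cp1 _ (6 * n + 2)) ?(@cp0 _ (2 * n)) //; lia.
- have -> : 36 * n + 30 = 12 * (3 * n + 2) + 6 by lia.
  by rewrite PDt_12n6 cp_3n2.
- have -> : 108 * n + 90 = 12 * (9 * n + 7) + 6 by lia.
  by rewrite PDt_12n6 (@cp1 _ (3 * n + 2)) ?cp_3n2 //; lia.
- exact: PDt_9k.
Qed.
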